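(* Let $\beta\in k_{\mathbb C}^*$ and suppose that $\alpha\in k^*_{\mathbb Z}$. (1) A point $(z,w)\in\mu_{\mathbb C}^{-1}(\beta)$ is $\alpha$-semi-stable if and only if $$\alpha\in\sum_{i=1}^N\mathbb R_{\ge0}|z_i|^2\,\iota^*u_i+\sum_{i=1}^N\mathbb R_{\ge0}|w_i|^2\,(-\iota^*u_i).$$ (2) Suppose $(z,w)\in\mu_{\mathbb C}^{-1}(\beta)^{\alpha\text{-}ss}$. Then the $K_{\mathbb C}$-orbit through $(z,w)$ is closed in $\mu_{\mathbb C}^{-1}(\beta)^{\alpha\text{-}ss}$ if and only if $$\alpha\in\sum_{i=1}^N\mathbb R_{>0}|z_i|^2\,\iota^*u_i+\sum_{i=1}^N\mathbb R_{>0}|w_i|^2\,(-\iota^*u_i).$$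
   Context: Identify $\mathbb H^N$ with $\mathbb C^N\times\mathbb C^N\ni(z,w)$. The torus $T^N=\{\zeta\in\mathbb C^N:|\zeta_i|=1\}$ acts on $\mathbb H^N$ on the right by $(z,w)\zeta=(z\zeta,w\zeta^{-1})$ (coordinatewise). Let $K\subset T^N$ be a connected subtorus with Lie algebra $k\subset t^N$, inclusion $\iota:k\to t^N$ and dual map $\iota^*:(t^N)^*\to k^*$; $k_{\mathbb C}=k\otimes\mathbb C$, and $K_{\mathbb C}$ is the complexification of $K$, acting on $\mathbb C^N\times\mathbb C^N$ by the same formula. $\{X_i\}$ is the standard basis of $t^N$ (with $\mathrm{Exp}(\sum a_iX_i)=(e^{2\pi\sqrt{-1}a_i})_i$) and $\{u_i\}$ the dual basis of $(t^N)^*$. Set $$\mu_{\mathbb C}(z,w)=-2\pi\sqrt{-1}\sum_{i=1}^N z_iw_i\,\iota^*u_i\in k_{\mathbb C}^*.$$ Put $t^N_{\mathbb Z}=\sum\mathbb ZX_i$, $k_{\mathbb Z}=k\cap t^N_{\mathbb Z}$, $k_{\mathbb Z}^*=\mathrm{Hom}(k_{\mathbb Z},\mathbb Z)\subset k^*$. An element $\alpha\in k_{\mathbb Z}^*$ induces the character $\chi_\alpha:K_{\mathbb C}\to\mathbb C^\times$, $\chi_\alpha(\mathrm{Exp}X)=e^{2\pi\sqrt{-1}\langle\alpha,X\rangle}$. A point $(z,w)\in\mu_{\mathbb C}^{-1}(\beta)$ is $\alpha$-semi-stable if there exist $m\in\mathbb Z_{>0}$ and a polynomial $f(p,q)$,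 $p,q\in\mathbb C^N$, such that $f((p,q)\zeta)=f(p,q)\chi_\alpha(\zeta)^m$ for all $\zeta\in K_{\mathbb C}$ and $f(z,w)\ne0$. The set of such points is $\mu_{\mathbb C}^{-1}(\beta)^{\alpha\text{-}ss}$. The sums denote Minkowski sums of the sets $\mathbb R_{\ge0}|z_i|^2\iota^*u_i=\{c|z_i|^2\iota^*u_i:c\ge0\}$ and similarly with $c>0$; thus indices with $z_i=0$ (resp. $w_i=0$) contribute only $\{0\}$. *)

(* Defs.v *)
From HB Require Import structures.
From mathcomp Require Import all_boot all_order all_algebra.
From mathcomp Require Import all_classical all_reals all_analysis.
From mathcomp Require Import complex ring lra.
From mathcomp.multinomials Require mpoly.

Set Implicit Arguments.
Unset Strict Implicit.
Unset Printing Implicit Defensive.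

Import Order.TTheory GRing.Theory Num.Theory.
Import numFieldNormedType.Exports.

Local Open Scope classical_set_scope.
Local Open Scope ring_scope.
Local Open Scope complex_scope.

(* [R[i]] carries its norm topology only under the alias [R[i]^o]; sets of
   complex vectors are cast to these types where a topology is needed. *)
Definition rVtop (R : realType) (N : nat) : topologicalType := 'rV[R[i]^o]_N.
Definition HNtop (R : realType) (N : nat) : topologicalType :=
  ('rV[R[i]^o]_N * 'rV[R[i]^o]_N)%type.

Section Dual.
Variables (F : fieldType) (N : nat).

Definition dual_space (k : {vspace 'rV[F]_N}) := 'Hom(subvs_of k, F^o).

Definition coordf (i : 'I_N) (X : 'rV[F]_N) : F^o := X 0 i.

Lemma coordf_is_linear i : linear (coordf i).
Proof. by move=> a X Y; rewrite /coordf !mxE. Qed.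

HB.instance Definition _ i :=
  GRing.isLinear.Build F 'rV[F]_N F^o *:%R (coordf i) (coordf_is_linear i).

(* the dual basis of (t^N)^*, for F = R, and of its complexification, for
   F = C *)
Definition dual_basis (i : 'I_N) : 'Hom('rV[F]_N, F^o) := linfun (coordf i).

(* iota^* : restriction of functionals along the inclusion of k *)
Definition iota_dual (k : {vspace 'rV[F]_N}) (f : 'Hom('rV[F]_N, F^o)) :
    dual_space k :=
  (f \o linfun (@vsval F 'rV[F]_N k))%VF.

Lemma iota_dualE k i (X : subvs_of k) : iota_dual k (dual_basis i) X = vsval X 0 i.
Proof. by rewrite /iota_dual /dual_basis comp_lfunE !lfunE. Qed.

End Dual.

Section Torus.
Variables (R : realType) (N : nat).
Implicit Types (K : set 'rV[R[i]]_N) (k : {vspace 'rV[R]_N}).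

Definition cexp (z : R[i]) : R[i] :=
  (expR (complex.Re z) * cos (complex.Im z)) +i*
  (expR (complex.Re z) * sin (complex.Im z)).

Definition twopii : R[i] := 0 +i* (2 * pi).

(* the exponential of the complex torus; [t^N] is the real subspace R^N *)
Definition torus_exp (X : 'rV[R[i]]_N) : 'rV[R[i]]_N :=
  map_mx (fun x => cexp (twopii * x)) X.

Definition toC (X : 'rV[R]_N) : 'rV[R[i]]_N := map_mx (real_complex R) X.
Definition ReV (X : 'rV[R[i]]_N) : 'rV[R]_N := map_mx (@complex.Re R) X.
Definition ImV (X : 'rV[R[i]]_N) : 'rV[R]_N := map_mx (@complex.Im R) X.

Definition mulV (a b : 'rV[R[i]]_N) : 'rV[R[i]]_N := \row_i (a 0 i * b 0 i).
Definition invV (a : 'rV[R[i]]_N) : 'rV[R[i]]_N := \row_i (a 0 i)^-1.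

Definition torus : set 'rV[R[i]]_N := [set a | forall i, `|a 0 i| = 1].

Record subtorus K : Prop := Subtorus {
  subtorus_sub : K `<=` torus;
  subtorus1 : K (const_mx 1);
  subtorusM : forall a b, K a -> K b -> K (mulV a b);
  subtorusV : forall a, K a -> K (invV a);
  subtorus_closed : closed (K : set (rVtop R N));
  subtorus_connected : connected (K : set (rVtop R N))
}.

Definition is_lie_algebra K k :=
  forall X : 'rV[R]_N, X \in k <-> forall t : R, K (torus_exp (toC (t *: X))).

(* k_C = k (x) C, inside C^N *)
Definition complexify k : {vspace 'rV[R[i]]_N} :=
  <<[seq toC X | X <- vbasis k]>>%VS.

(* K_C : a connected K is Exp k, and its complexification is Exp k_C *)
Definition KC k : set 'rV[R[i]]_N := torus_exp @` [set X | X \in complexify k].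

(* k_Z^*, as the functionals on k taking integral values on k_Z *)
Definition integral_dual k (alpha : dual_space k) :=
  forall X : subvs_of k, (forall i, vsval X 0 i \is a Num.int) ->
    alpha X \is a Num.int.

(* the complex-linear extension of alpha, evaluated at X in k_C *)
Definition pairing k (alpha : dual_space k) (X : 'rV[R[i]]_N) : R[i] :=
  (alpha (vsproj k (ReV X)) : R) +i* (alpha (vsproj k (ImV X)) : R).

(* Well defined when alpha is integral : the value at a does not depend on the
   logarithm of a chosen in k_C, see [chiE]. *)
Definition chi k (alpha : dual_space k) (a : 'rV[R[i]]_N) : R[i] :=
  cexp (twopii *
    pairing alpha (xget 0 [set X | X \in complexify k /\ torus_exp X = a])).

Lemma toC_complexify k (Y : 'rV[R]_N) : Y \in k -> toC Y \in complexify k.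
Proof.
move=> /coord_vbasis ->.
have -> : toC (\sum_(i < \dim k) coord (vbasis k) i Y *: (vbasis k)`_i) =
    \sum_(i < \dim k)
      real_complex R (coord (vbasis k) i Y) *: toC (vbasis k)`_i.
  rewrite /toC raddf_sum; apply: eq_bigr => i _.
  by apply/rowP => j; rewrite !mxE; exact: rmorphM.
apply: memv_suml => i _; apply/memvZ/memv_span/map_f/mem_nth.
by rewrite size_tuple.
Qed.

Lemma complexifyP k (X : 'rV[R[i]]_N) :
  X \in complexify k <-> (ReV X \in k) /\ (ImV X \in k).
Proof.
split=> [|[Xr Xi]]; last first.
  have -> : X = toC (ReV X) + 'i *: toC (ImV X).
    by apply/rowP => j; rewrite !mxE [LHS]complexE.
  by apply: memvD; [|apply: memvZ]; exact: toC_complexify.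
move=> Xk; have [c ->] : exists c : 'I_(\dim k) -> R[i],
    X = \sum_(i < \dim k) c i *: (map toC (vbasis k))`_i.
  exists (fun i => coord (map_tuple toC (vbasis k)) i X).
  by rewrite [LHS](@coord_span _ _ _ (map_tuple toC (vbasis k))).
have e i : (i < \dim k)%N -> (map toC (vbasis k))`_i = toC (vbasis k)`_i.
  by move=> ik; rewrite (nth_map 0) // size_tuple.
split.
  have -> : ReV (\sum_(i < \dim k) c i *: (map toC (vbasis k))`_i) =
      \sum_(i < \dim k) complex.Re (c i) *: (vbasis k)`_i.
    apply/rowP => j; rewrite mxE !summxE raddf_sum; apply: eq_bigr => i _.
    by rewrite e // !mxE; case: (c i) => a b /=; rewrite mulr0 subr0.
  by apply: memv_suml => i _; apply/memvZ/vbasis_mem/mem_nth; rewrite size_tuple.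
have -> : ImV (\sum_(i < \dim k) c i *: (map toC (vbasis k))`_i) =
    \sum_(i < \dim k) complex.Im (c i) *: (vbasis k)`_i.
  apply/rowP => j; rewrite mxE !summxE raddf_sum; apply: eq_bigr => i _.
  by rewrite e // !mxE; case: (c i) => a b /=; rewrite mulr0 add0r.
by apply: memv_suml => i _; apply/memvZ/vbasis_mem/mem_nth; rewrite size_tuple.
Qed.

Lemma cos_eq1 (x : R) : cos x = 1 -> exists n : int, x = n%:~R * (pi *+ 2).
Proof.
move=> cx; have p0 : 0 < pi *+ 2 :> R by rewrite pmulrn_lgt0 // pi_gt0.
have cosDn (y : R) (n : nat) : cos (y + n%:R * (pi *+ 2)) = cos y.
  by rewrite mulr_natl (periodicn (@cosD2pi R)).
pose n := Num.floor (x / (pi *+ 2)); exists n.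
pose y := x - n%:~R * (pi *+ 2).
have cy : cos y = 1.
  rewrite -cx {}/y; case: n => m; rewrite ?NegzE ?mulrNz ?mulNr ?opprK.
    by rewrite -[in RHS](subrK (m%:R * (pi *+ 2)) x) cosDn.
  by rewrite cosDn.
have y0 : 0 <= y by rewrite subr_ge0 -ler_pdivlMr // floor_le.
have y1 : y < pi *+ 2.
  rewrite ltrBlDr -[ltRHS](_ : (n + 1)%:~R * (pi *+ 2) = _).
    by rewrite -ltr_pdivrMr // floorD1_gt.
  by rewrite rmorphD /= mulrDl mul1r addrC.
have I0 : 0 \in `[0, pi : R] by rewrite in_itv /= lexx pi_ge0.
apply/eqP; rewrite -subr_eq0 -/y; apply/eqP.
have [yp|py] := leP y pi.
  by apply: cos_inj; rewrite ?cos0 // in_itv /= y0.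
have : pi *+ 2 - y = 0.
  apply: cos_inj; rewrite ?cos0 //.
    by rewrite in_itv /= subr_ge0 ltW //= mulr2n lerBlDr lerD2l ltW.
  by rewrite -cosN opprB -(cosD2pi (y - _)) subrK.
by move=> /eqP; rewrite subr_eq0 => /eqP e; rewrite -e ltxx in y1.
Qed.

Lemma cexpD (x y : R[i]) : cexp (x + y) = cexp x * cexp y.
Proof.
case: x y => [a b] [c d]; rewrite /cexp /= expRD cosD sinD.
by apply/eqP; rewrite eq_complex /=; apply/andP; split; apply/eqP; ring.
Qed.

Lemma cexp0 : cexp 0 = 1.
Proof. by rewrite /cexp /= expR0 cos0 sin0 mulr1 mulr0. Qed.

Lemma cexp_neq0 x : cexp x != 0.
Proof.
apply/eqP => e; have := cexpD x (- x); rewrite subrr cexp0 e mul0r.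
by move=> /eqP; rewrite oner_eq0.
Qed.

Lemma cexp_twopii_int (n : int) : cexp (twopii * (n%:~R : R)%:C) = 1.
Proof.
have nat_case (m : nat) : cexp (twopii * (m%:R : R)%:C) = 1.
  elim: m => [|m IH]; first by rewrite mulr0 cexp0.
  rewrite -natr1 rmorphD /= mulrDr cexpD IH mul1r /twopii /cexp /=.
  rewrite !(mul0r, mulr0, subr0, mulr1, addr0, add0r, expR0, mul1r).
  by rewrite mulr_natl cos2pi sin2pi oppr0 expR0 mulr0 mulr1.
case: n => m; first exact: nat_case.
apply: (mulfI (cexp_neq0 (twopii * (m.+1%:R : R)%:C))).
rewrite -cexpD -mulrDr -rmorphD /= NegzE mulrNz subrr mulr0 cexp0 nat_case.
by rewrite mul1r.
Qed.

Lemma cexp_twopii_eq1 (z : R[i]) :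
  cexp (twopii * z) = 1 -> exists n : int, z = (n%:~R : R)%:C.
Proof.
case: z => a b; rewrite /twopii /cexp /= !mul0r sub0r add0r.
case=> ea eb.
have s0 : sin (2 * pi * a) = 0.
  by move/eqP: eb; rewrite mulf_eq0 gt_eqF ?expR_gt0 //= => /eqP.
have /eqP := sin0cos1 s0; rewrite eqr_norml ler01 andbT => /orP[/eqP c1|/eqP c1].
  move: ea; rewrite c1 mulr1 => /eqP; rewrite -[X in _ == X]expR0 (inj_eq (@expR_inj R)) oppr_eq0 !mulf_eq0.
  rewrite pnatr_eq0 /= gt_eqF ?pi_gt0 //= => /eqP ->.
  have [n en] := cos_eq1 c1; exists n; congr (_ +i* _).
  have p0 : 2 * pi != 0 :> R by rewrite mulf_neq0 ?pnatr_eq0 // gt_eqF ?pi_gt0.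
  by apply: (mulfI p0); rewrite en [LHS]mulrC mulr_natl.
have := expR_gt0 (- (2 * pi * b)).
by move: ea; rewrite c1 mulrN1 => /eqP; rewrite eqr_oppLR => /eqP ->; rewrite ltr0N1.
Qed.

Lemma chiE k (alpha : dual_space k) (X : 'rV[R[i]]_N) :
  integral_dual alpha -> X \in complexify k ->
  chi alpha (torus_exp X) = cexp (twopii * pairing alpha X).
Proof.
move=> alphaZ Xk; rewrite /chi.
case: xgetP => [Y _ [Yk EY]|/(_ X)]; last by move=> /(_ (conj Xk erefl)).
have [Xr Xi] := (complexifyP k X).1 Xk.
have [Yr Yi] := (complexifyP k Y).1 Yk.
have YX j : exists n : int, Y 0 j - X 0 j = (n%:~R : R)%:C.
  apply: cexp_twopii_eq1; apply: (mulIf (cexp_neq0 (twopii * X 0 j))).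
  by rewrite -cexpD -mulrDr subrK mul1r; move/rowP: EY => /(_ j); rewrite !mxE.
have Im0 : ImV Y = ImV X.
  apply/rowP => j; rewrite !mxE; have [n] := YX j.
  by case: (Y 0 j) (X 0 j) => [a b] [c d] [_ /eqP]; rewrite subr_eq0 => /eqP.
have /alphaZ : forall j, vsval (vsproj k (ReV Y - ReV X)) 0 j \is a Num.int.
  move=> j; rewrite vsprojK ?memvB // !mxE; have [n] := YX j.
  case: (Y 0 j) (X 0 j) => [a b] [c d] [/= -> _]; exact: intr_int.
rewrite linearB linearB /= => /intrP [n en].
rewrite /pairing Im0.
have -> : alpha (vsproj k (ReV Y)) =
    alpha (vsproj k (ReV X)) + n%:~R by rewrite -en addrC subrK.
rewrite -[_ +i* _ in LHS](_ : ((alpha (vsproj k (ReV X)) : R) +i*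
    (alpha (vsproj k (ImV X)) : R)) + (n%:~R : R)%:C = _); last first.
  by apply/eqP; rewrite eq_complex /= addr0 !eqxx.
by rewrite mulrDr cexpD cexp_twopii_int mulr1.
Qed.

End Torus.

Section Minkowski.
Variables (R : realType) (V : lmodType R).

Definition minkowski_sum (A B : set V) : set V := [set a + b | a in A & b in B].

Definition ray_ge0 (v : V) : set V := [set c *: v | c in [set c : R | 0 <= c]].
Definition ray_gt0 (v : V) : set V := [set c *: v | c in [set c : R | 0 < c]].

End Minkowski.

Section Quaternionic.
Variables (R : realType) (N : nat) (k : {vspace 'rV[R]_N}).

Definition HN := ('rV[R[i]]_N * 'rV[R[i]]_N)%type.

Definition torus_act (x : HN) (a : 'rV[R[i]]_N) : HN :=
  (mulV x.1 a, mulV x.2 (invV a)).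

Definition KC_orbit (x : HN) : set HN := [set torus_act x a | a in KC k].

Definition muC (x : HN) : dual_space (complexify k) :=
  (- twopii R) *: \sum_(i < N)
    (x.1 0 i * x.2 0 i) *: iota_dual (complexify k) (dual_basis _ i).

Definition polyeval (f : mpoly.mpoly (N + N) R[i]) (x : HN) : R[i] :=
  mpoly.meval (fun j => row_mx x.1 x.2 0 j) f.

Definition semistable (alpha : dual_space k) (x : HN) : Prop :=
  exists m : nat, (0 < m)%N /\
  exists f : mpoly.mpoly (N + N) R[i],
    (forall (y : HN) (a : 'rV[R[i]]_N), KC k a ->
       polyeval f (torus_act y a) = polyeval f y * chi alpha a ^+ m) /\
    polyeval f x != 0.

Definition muC_ss (beta : dual_space (complexify k)) (alpha : dual_space k) :
    set HN :=
  [set x | muC x = beta /\ semistable alpha x].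

(* A is a closed subset of the subspace S of H^N *)
Definition closed_in (S A : set HN) : Prop :=
  exists2 F : set HN, closed (F : set (HNtop R N)) & A = S `&` F.

Definition normsq (z : R[i]) : R := complex.Re z ^+ 2 + complex.Im z ^+ 2.

Definition cone_ge0 (x : HN) : set (dual_space k) :=
  minkowski_sum
    (\big[@minkowski_sum _ _/[set 0]]_(i < N)
       ray_ge0 (normsq (x.1 0 i) *: iota_dual k (dual_basis _ i)))
    (\big[@minkowski_sum _ _/[set 0]]_(i < N)
       ray_ge0 (normsq (x.2 0 i) *: - iota_dual k (dual_basis _ i))).

Definition cone_gt0 (x : HN) : set (dual_space k) :=
  minkowski_sum
    (\big[@minkowski_sum _ _/[set 0]]_(i < N)
       ray_gt0 (normsq (x.1 0 i) *: iota_dual k (dual_basis _ i)))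
    (\big[@minkowski_sum _ _/[set 0]]_(i < N)
       ray_gt0 (normsq (x.2 0 i) *: - iota_dual k (dual_basis _ i))).

End Quaternionic.

Arguments complexify {R N} k.
Arguments KC {R N} k _.
Arguments muC {R N} k x.
Arguments KC_orbit {R N} k x _.
Arguments cone_ge0 {R N} k x _.
Arguments cone_gt0 {R N} k x _.

(* Main.v *)
Require Import Defs.
From HB Require Import structures.
From mathcomp Require Import all_boot all_order all_algebra.
From mathcomp Require Import all_classical all_reals all_analysis.
From mathcomp Require Import complex ring.
From mathcomp.multinomials Require mpoly.
Import Order.TTheory GRing.Theory Num.Theory.
Import numFieldNormedType.Exports.
Set Implicit Arguments.
Unset Strict Implicit.
Unset Printing Implicit Defensive.
Local Open Scope classical_set_scope.
Local Open Scope ring_scope.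
Local Open Scope complex_scope.

(* The Lie algebra k is spanned by integer vectors: by Dirichlet, multiples of
   X in k come arbitrarily close to integer vectors, and the small differences,
   being logarithms of elements of the closed group K, lie in k.  Hence K_C acts
   diagonally on the 2N coordinates (z, w) through integer weights, and alpha
   becomes an integer weight a.
   If a lies in the real cone of the weights at the nonzero coordinates of x,
   Farkas' lemma over Q gives rational coefficients, hence a semi-invariant
   monomial; otherwise Farkas' lemma over R gives a one-parameter subgroup along
   which x converges while the inverse of the character tends to 0, so that
   every semi-invariant vanishes at x.
   If a lies in the cone, but not with positive coefficients, Motzkin's
   alternative gives a one-parameter subgroup on which the character is trivial
   and which moves x to a semistable limit with more vanishing coordinates.
   Conversely, a monomial with positive exponents forces the semistable points in
   the closure of the orbit to have the support of x, and binomial equations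
   read off a Smith normal form put them in the orbit. *)

(** * Theorems of the alternative *)

Section Farkas.
Variables (F : realFieldType) (d : nat).
Implicit Types (b : 'cV[F]_d) (X : 'rV[F]_d).

(** Induction on the generators. If the tail alone does not force nonnegativity on [b], some [X0] is
    nonnegative on the tail and negative on [b], hence negative on [g j0]; projecting along [g j0]
    onto the kernel of [X0] reduces to the tail. *)
Lemma farkas (J : eqType) (s : seq J) (g : J -> 'cV[F]_d) b : uniq s ->
  (forall X, (forall j, j \in s -> 0 <= (X *m g j) 0 0) -> 0 <= (X *m b) 0 0) ->
  exists2 c : J -> F, forall j, 0 <= c j & b = \sum_(j <- s) c j *: g j.
Proof.
elim: s g b => [|j0 s IH] g b /=.
  move=> _ bge0; exists (fun=> 0) => //; rewrite big_nil.
  apply/colP => r; rewrite !mxE; apply/eqP; rewrite eq_le.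
  have br e : ((e *: delta_mx 0 r : 'rV_d) *m b) 0 0 = e * b r 0.
    by rewrite -scalemxAl mxE -rowE mxE.
  have := bge0 ((-1) *: delta_mx 0 r) (fun j (h : j \in [::]) => False_ind _ (notF h)).
  have := bge0 (1 *: delta_mx 0 r) (fun j (h : j \in [::]) => False_ind _ (notF h)).
  by rewrite !br mulN1r mul1r oppr_ge0 => -> ->.
move=> /andP[j0s us] bge0.
have [bge0'|] := pselect (forall X,
    (forall j, j \in s -> 0 <= (X *m g j) 0 0) -> 0 <= (X *m b) 0 0).
  have [c c0 ->] := IH g b us bge0'.
  exists (fun j => if j == j0 then 0 else c j) => [j|]; first by case: eqP.
  rewrite big_cons eqxx scale0r add0r; apply: eq_big_seq => j js.
  by case: eqP => // ej; rewrite ej (negPf j0s) in js.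
move=> /existsNP[X0 /not_implyP[X0g /negP]]; rewrite -ltNge => X0b.
have X0j0 : (X0 *m g j0) 0 0 < 0.
  rewrite ltNge; apply/negP => h; suff : 0 <= (X0 *m b) 0 0 by rewrite leNgt X0b.
  by apply: bge0 => j; rewrite inE => /predU1P[->|/X0g].
pose t := (X0 *m g j0) 0 0.
(* Bartl's reduction: project along X0 onto the hyperplane where g j0 vanishes *)
pose pr (v : 'cV[F]_d) := v - ((X0 *m v) 0 0 / t) *: g j0.
have subE (A C : 'M[F]_1) : (A - C) 0 0 = A 0 0 - C 0 0 by rewrite !mxE.
have scaleE e (A : 'M[F]_1) : (e *: A) 0 0 = e * A 0 0 by rewrite mxE.
have prE X v : (X *m pr v) 0 0 = ((X - ((X *m g j0) 0 0 / t) *: X0) *m v) 0 0.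
  rewrite /pr mulmxBr mulmxBl -scalemxAr -scalemxAl !subE !scaleE; congr (_ - _).
  by rewrite mulrAC [RHS]mulrAC [X in X / _]mulrC.
have t0 : t != 0 by rewrite lt_eqF.
have [|c c0 eb] := IH (fun j => pr (g j)) (pr b) us.
  move=> X hX; rewrite prE; apply: bge0 => j; rewrite inE => /predU1P[->|js].
    rewrite mulmxBl -scalemxAl subE scaleE.
    by rewrite divfK // subrr.
  by rewrite -prE hX.
(* The value forced by applying [X0] to the desired identity; numerator and [t] are both
   negative. *)
pose c0' := ((X0 *m b) 0 0 - \sum_(j <- s) c j * (X0 *m g j) 0 0) / t.
exists (fun j => if j == j0 then c0' else c j) => [j|].
  case: eqP => // _; rewrite /c0' mulr_le0 ?invr_le0 ?(ltW X0j0) //.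
  rewrite subr_le0 (le_trans (ltW X0b)) // big_seq sumr_ge0 // => i is_.
  by rewrite mulr_ge0 ?c0 ?X0g.
rewrite big_cons eqxx (eq_big_seq (fun j => c j *: g j)); last first.
  by move=> j js; case: eqP => // ej; rewrite ej (negPf j0s) in js.
have {}eb : b = ((X0 *m b) 0 0 / t) *: g j0 + \sum_(j <- s) c j *: pr (g j).
  by rewrite -eb /pr addrC subrK.
rewrite {1}eb /pr (eq_bigr (fun j => c j *: g j - (c j * (X0 *m g j) 0 0 / t) *: g j0)).
  rewrite sumrB -scaler_suml addrCA addrC -scalerBl; congr (_ *: _ + _).
  by rewrite /c0' mulrBl mulr_suml.
by move=> j _; rewrite scalerBr scalerA mulrA.
Qed.

(** Farkas' lemma is applied to the target [- \sum g j] with generators [g j] and [- b]: success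
    writes a multiple of [b] with coefficients at least 1, failure yields the functional [X]. *)
Lemma motzkin (J : finType) (P : {pred J}) (g : J -> 'cV[F]_d) (c : J -> F) :
  (forall j, 0 <= c j) ->
  (exists2 c' : J -> F, forall j, 0 < c' j &
     \sum_(j in P) c j *: g j = \sum_(j in P) c' j *: g j) \/
  (exists X, [/\ forall j, j \in P -> 0 <= (X *m g j) 0 0,
     (X *m \sum_(j in P) c j *: g j) 0 0 = 0 &
     exists2 j, j \in P & 0 < (X *m g j) 0 0]).
Proof.
move=> c0; set b := \sum_(j in P) _.
pose g' (o : option J) := if o is Some j then g j else - b.
pose s := None :: map Some (enum P).
have us : uniq s.
  rewrite /= map_inj_uniq ?enum_uniq; last by move=> ? ? [].
  by rewrite andbT; apply/mapP => -[].
have evals X (f : J -> F) : (X *m \sum_(j in P) f j *: g j) 0 0 =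
    \sum_(j in P) f j * (X *m g j) 0 0.
  by rewrite mulmx_sumr summxE; apply: eq_bigr => j _; rewrite -scalemxAr mxE.
have [h|] := pselect (forall X, (forall o, o \in s -> 0 <= (X *m g' o) 0 0) ->
    0 <= (X *m - \sum_(j in P) 1 *: g j) 0 0).
  left; have [e e0] := farkas us h.
  rewrite big_cons big_map big_enum /= => es.
  have eb : e None *: b = \sum_(j in P) (1 + e (Some j)) *: g j.
    rewrite (eq_bigr _ (fun j _ => scalerDl (g j) 1 (e (Some j)))) big_split /=.
    by rewrite -[X in _ = X + _]opprK es scalerN opprD opprK subrK.
  (* If [e None = 0], the coefficients [1 + e (Some j)] form a strictly positive relation among the
     generators, which is added to [c]; otherwise one divides by [e None]. *)
  have [t0|t0] := eqVneq (e None) 0.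
    exists (fun j => c j + (1 + e (Some j))) => [j|].
      by rewrite ltr_wpDl ?c0 // ltr_wpDr.
    rewrite (eq_bigr _ (fun j _ => scalerDl (g j) (c j) _)) big_split /= -eb.
    by rewrite t0 scale0r addr0.
  have tp : 0 < e None by rewrite lt_def t0 e0.
  exists (fun j => (1 + e (Some j)) / e None) => [j|].
    by rewrite divr_gt0 // ltr_wpDr.
  apply: (scalerI t0); rewrite eb scaler_sumr; apply: eq_bigr => j _.
  by rewrite scalerA mulrC divfK.
move=> /existsNP[X /not_implyP[hX /negP]]; rewrite -ltNge mulmxN mxE oppr_lt0 evals => Xs.
right; exists X; have Xg j : j \in P -> 0 <= (X *m g j) 0 0.
  by move=> jP; apply: (hX (Some j)); rewrite inE /= map_f // mem_enum.
split=> //.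
  apply/eqP; rewrite eq_le; apply/andP; split; last first.
    by rewrite evals sumr_ge0 // => j jP; rewrite mulr_ge0 ?Xg.
  by have := hX None (mem_head _ _); rewrite /= mulmxN mxE oppr_ge0.
apply: contrapT => nex; move: Xs; rewrite big1 ?ltxx // => j jP.
apply/eqP; rewrite mul1r eq_le Xg // andbT leNgt; apply/negP => h; apply: nex; by exists j.
Qed.

End Farkas.

(** * Integer matrices and cones of integer vectors *)

Lemma common_denominator (J : finType) (c : J -> rat) : (forall j, 0 <= c j) ->
  exists2 m : nat, (0 < m)%N &
    exists n : J -> nat, forall j, c j * m%:R = (n j)%:R.
Proof.
move=> c0; exists (\prod_j `|denq (c j)|)%N.
  by rewrite prodn_gt0 // => j; rewrite absz_gt0 denq_neq0.
exists (fun j => `|numq (c j)| * \prod_(i | i != j) `|denq (c i)|)%N => j.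
rewrite (bigD1 j) //= !natrM mulrA; congr (_ * _).
rewrite !pmulrn !gez0_abs ?numq_ge0 ?denq_ge0 // -[X in X * _]divq_num_den.
by rewrite divfK // intr_eq0 denq_neq0.
Qed.

Definition intmx (F : pzRingType) m n (A : 'M[int]_(m, n)) : 'M[F]_(m, n) :=
  map_mx intr A.

Lemma intmxE (F : pzRingType) m n (A : 'M[int]_(m, n)) i j :
  intmx F A i j = (A i j)%:~R.
Proof. exact: mxE. Qed.

Lemma intmxB (F : pzRingType) m n (A B : 'M[int]_(m, n)) :
  intmx F (A - B) = intmx F A - intmx F B.
Proof. exact: raddfB. Qed.

Lemma intmx_inj (F : numDomainType) m n : injective (@intmx F m n).
Proof.
move=> A B /matrixP AB; apply/matrixP => i j.
by have := AB i j; rewrite !intmxE => /intr_inj.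
Qed.

Section IntegerCone.
Variables (R : realType) (d M : nat) (G : 'M[int]_(d, M)) (a : 'cV[int]_d).
Variable P : {pred 'I_M}.

(** A rational functional nonnegative on the generators is nonnegative on [a], by the real
    representation; Farkas' lemma over the rationals then gives rational coefficients, whose
    denominators are cleared. *)
Lemma nat_cone (c : 'I_M -> R) : (forall j, 0 <= c j) ->
  intmx R a = \sum_(j in P) c j *: intmx R (col j G) ->
  exists m : nat, exists n : 'I_M -> nat, [/\ (0 < m)%N,
    a *+ m = \sum_(j in P) col j G *+ n j &
    (forall j, 0 < c j) -> forall j, (0 < n j)%N].
Proof.
move=> c0 ea; pose g j := intmx rat (col j G).
have ratE (X : 'rV[rat]_d) (v : 'cV[int]_d) :
    ratr ((X *m intmx rat v) 0 0) = (map_mx ratr X *m intmx R v) 0 0.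
  rewrite !mxE rmorph_sum; apply: eq_bigr => r _.
  by rewrite !mxE rmorphM /= ratr_int.
have evalE (X : 'rV[rat]_d) : ratr ((X *m intmx rat a) 0 0) =
    \sum_(j in P) c j * ratr ((X *m g j) 0 0).
  rewrite ratE ea mulmx_sumr summxE; apply: eq_bigr => j _.
  by rewrite -scalemxAr mxE ratE.
have [|e e0] := @farkas _ _ _ (enum P) g (intmx rat a) (enum_uniq _).
  move=> X hX; rewrite -(ler0q R) evalE sumr_ge0 // => j jP.
  by rewrite mulr_ge0 // ler0q hX // mem_enum.
rewrite big_enum /= => eE.
have [f [f0 fE fp]] : exists f : 'I_M -> rat, [/\ forall j, 0 <= f j,
    intmx rat a = \sum_(j in P) f j *: g j &
    (forall j, 0 < c j) -> forall j, 0 < f j].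
  have [[f f0 fE]|[X [Xg Xa [j jP Xj]]]] := motzkin P g e0.
    by exists f; split=> [j||//]; [exact: ltW|rewrite eE].
  (* Positive real coefficients exclude this alternative: [X] vanishes on [a], which is a positive
     combination of generators where [X] is nonnegative and not always zero. *)
  exists e; split=> // cp; exfalso; move/eqP: Xa; rewrite -eE.
  rewrite -(fmorph_eq0 (@ratr R)) /= evalE psumr_eq0 => [|i iP]; last first.
    by rewrite mulr_ge0 // ler0q Xg.
  move=> /allP/(_ j (mem_index_enum _))/implyP/(_ jP).
  by rewrite mulf_eq0 fmorph_eq0 !gt_eqF.
have [m m0 [n nE]] := common_denominator f0; exists m, n; split=> //.
  apply: (@intmx_inj rat); rewrite /intmx.
  rewrite raddfMn raddf_sum /= -/(intmx rat a) fE -sumrMnl; apply: eq_bigr => j _.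
  rewrite raddfMn /= -[RHS]scaler_nat -nE.
  by rewrite -scaler_nat scalerA mulrC.
move=> cp j; have : 0 < f j * m%:R by rewrite mulr_gt0 ?fp ?ltr0n.
by rewrite nE ltr0n.
Qed.

End IntegerCone.

(** * Closed subgroups of Euclidean space *)

Section ClosedSubgroups.
Variables (R : realType) (N : nat).
Implicit Types (X Y : 'rV[R]_N) (L A : set 'rV[R]_N) (k : {vspace 'rV[R]_N}).

Lemma norm_eq0_eps X : (forall e, 0 < e -> `|X| < e) -> X = 0.
Proof.
move=> h; apply/eqP; rewrite -normr_eq0; apply: contraT => X0.
by have := h `|X|; rewrite lt_def X0 normr_ge0 ltxx => /(_ isT).
Qed.

Lemma closed_approx A X : closed A ->
  (forall e, 0 < e -> exists2 Y, A Y & `|X - Y| < e) -> A X.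
Proof.
move=> Acl h; apply: Acl => B /nbhs_normP[e /= e0 sB].
by have [Y AY XY] := h e e0; exists Y; split=> //; apply: sB.
Qed.

Lemma ler_coord_norm X i : `|X 0 i| <= `|X|.
Proof.
rewrite [leRHS]/Num.Def.normr /= mx_normrE.
exact: (le_bigmax _ (fun ij : 'I_1 * 'I_N => `|X ij.1 ij.2|) (0, i)).
Qed.

Lemma ler_norm_coord X e : 0 <= e -> (forall i, `|X 0 i| <= e) -> `|X| <= e.
Proof.
move=> e0 h; rewrite [leLHS]/Num.Def.normr /= mx_normrE; apply/bigmax_leP.
by split=> // -[j i] _ /=; rewrite ord1.
Qed.

Lemma bounded_seq_cluster (v : nat -> 'rV[R]_N) : (forall n, `|v n| <= 1) ->
  exists X, forall e n, 0 < e -> exists2 m, (n <= m)%N & `|X - v m| < e.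
Proof.
move=> v1; pose A := [set X : 'rV[R]_N | `|X| <= 1].
have cA : compact A.
  apply: bounded_closed_compact.
    by exists 1; split=> // t t1 X /= /le_trans; apply; exact: ltW.
  apply: (@closed_comp _ _ (fun X : 'rV[R]_N => `|X|) [set t : R | t <= 1]).
    by move=> X _; exact: norm_continuous.
  exact: closed_le.
have [|X [_ cX]] := cA (v @ \oo) (fmap_proper_filter v eventually_filter).
  by exists 0%N => // n _; exact: v1.
exists X => e n e0.
have [||Y [[m /= nm <-] Xm]] := cX (v @` [set m | (n <= m)%N])
    [set Y | `|X - Y| < e] _ _.
- by exists n => // m nm; exists m.
- by apply: (@nbhs_le_nbhs_norm R 'rV[R]_N X); exists e.
by exists m.
Qed.

Lemma lfun_bounded (f : 'End('rV[R]_N)) :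
  exists2 C, 0 < C & forall X, `|f X| <= C * `|X|.
Proof.
exists (1 + \sum_i `|f (delta_mx 0 i)|) => [|X].
  by rewrite ltr_wpDr // sumr_ge0.
rewrite {1}(row_sum_delta X) linear_sum (le_trans (ler_norm_sum _ _ _)) //.
rewrite mulrDl mul1r ler_wpDl // mulr_suml ler_sum // => i _.
by rewrite linearZ normrZ mulrC ler_wpM2l // ler_coord_norm.
Qed.

(* The part of a short element of L transverse to k is again in L; if it were
   nonzero, its integer multiples would accumulate on a line contained in L
   and transverse to k. *)
Lemma small_mem_lines L k : closed L -> (forall X Y, L X -> L Y -> L (X - Y)) ->
  (forall X, X \in k <-> forall t, L (t *: X)) ->
  exists2 e, 0 < e & forall Y, L Y -> `|Y| < e -> Y \in k.
Proof.
move=> Lcl LB hk.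
have kL X : X \in k -> L X by move=> /hk/(_ 1); rewrite scale1r.
have L0 : L 0 by apply/kL/mem0v.
have LN X : L X -> L (- X) by move=> LX; rewrite -sub0r; exact: LB.
have LMn X n : L X -> L (X *+ n).
  by move=> LX; elim: n => // n IH; rewrite mulrSr -[X in _ + X]opprK; apply/LB/LN.
have LMz X (z : int) : L X -> L (X *~ z).
  by move=> LX; case: z => n; [|rewrite NegzE mulrNz; apply: LN]; exact: LMn.
apply: contrapT => nex.
have far e : 0 < e -> exists Y, [/\ L Y, `|Y| < e & Y \notin k].
  move=> e0; apply: contrapT => h; apply: nex; exists e => // Y LY Ye.
  by apply: contraT => Yk; exfalso; apply: h; exists Y.
have [C C0 fC] := lfun_bounded (\1 - projv k)%VF.
have [D D0 fD] := lfun_bounded (projv k).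
have [|q qP] := @choice nat 'rV[R]_N (fun n Y =>
    [/\ L Y, 0 < `|Y|, `|Y| < n.+1%:R^-1 & projv k Y = 0]).
  (* [C] bounds the projection off [k], so this radius makes the transverse part shorter than
     [1 / (n + 1)]. *)
  move=> n; have [|Y [LY Ye Yk]] := far (C^-1 / n.+1%:R).
    by rewrite divr_gt0 ?invr_gt0.
  exists (Y - projv k Y); split.
  - by apply: LB => //; apply/kL/memv_proj.
  - rewrite normr_gt0 subr_eq0; apply: contraNneq Yk => ->; exact: memv_proj.
  - have := fC Y; rewrite add_lfunE opp_lfunE id_lfunE => /le_lt_trans; apply.
    by rewrite mulrC -ltr_pdivlMr // mulrC.
  - by rewrite linearB /= [projv k (projv _ _)]projv_id ?memv_proj // subrr.
have qn0 n : `|q n| != 0 by case: (qP n) => _ /lt0r_neq0.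
pose v n := `|q n|^-1 *: q n.
have v1 n : `|v n| = 1 by rewrite normrZ normfV normr_id mulVf.
have [w wP] : exists X, forall e n, 0 < e ->
    exists2 m, (n <= m)%N & `|X - v m| < e.
  by apply: bounded_seq_cluster => n; rewrite v1.
have wk : projv k w = 0.
  apply: norm_eq0_eps => e e0.
  have [|m _ wm] := wP (e / D) 0%N; first by rewrite divr_gt0.
  have [_ _ _ qm] := qP m.
  rewrite (_ : projv k w = projv k (w - v m)).
    by apply: (le_lt_trans (fD _)); rewrite mulrC -ltr_pdivlMr.
  by rewrite linearB /= linearZ /= qm scaler0 subr0.
have w_in : w \in k.
  (* The multiple of [q m] by the integer part of [t / |q m|] approximates [t *: w], with error at
     most [|t|] times the distance from [w] to [v m], plus [|q m|]. Using [1 + |t|] avoids a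
     division by zero. *)
  apply/hk => t; apply: closed_approx Lcl _ => e e0.
  have e2 : 0 < e / 2 by rewrite divr_gt0.
  have [n _ ne] : exists2 n : nat, True & n.+1%:R^-1 < e / 2.
    exists (Num.truncn (e / 2)^-1) => //.
    by rewrite invf_plt ?posrE // truncnS_gt.
  have t1 : 0 < 1 + `|t| by rewrite ltr_wpDr.
  have [|m nm wm] := wP (e / 2 / (1 + `|t|)) n; first by rewrite divr_gt0.
  have [Lq q0 qe _] := qP m.
  exists (q m *~ Num.floor (t / `|q m|)); first exact: LMz.
  rewrite (_ : _ - _ = t *: (w - v m) +
      (t / `|q m| - (Num.floor (t / `|q m|))%:~R) *: q m); last first.
    by rewrite scalerBr scalerBl scaler_int scalerA addrA subrK.
  rewrite (le_lt_trans (ler_normD _ _)) // [ltRHS]splitr ltrD //.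
    rewrite normrZ (@le_lt_trans _ _ ((1 + `|t|) * `|w - v m|)) //.
      by rewrite ler_wpM2r // lerDr.
    by rewrite mulrC -ltr_pdivlMr.
  rewrite normrZ (@le_lt_trans _ _ `|q m|) //.
    rewrite ler_piMl // ger0_norm ?subr_ge0 ?floor_le // ltW //.
    by rewrite ltrBlDl -[X in _ + X]/(1%:~R) -intrD floorD1_gt.
  apply: lt_trans qe _; apply: le_lt_trans ne.
  by rewrite lef_pV2 ?posrE // ler_nat.
(* Being in [k] with zero projection to [k], [w] is 0, yet the unit vectors [v m] cluster at it. *)
have := wP 1 0%N ltr01; rewrite (_ : w = 0); last by rewrite -(projv_id w_in).
by case=> m _; rewrite sub0r normrN v1 ltxx.
Qed.

(** Dirichlet approximation by compactness: the fractional parts of [X *+ n] stay in the unit cube,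
    so those at two indices [m < n] are [e]-close, and [q] is [n - m]. *)
Lemma simultaneous_approx X e : 0 < e ->
  exists (q : nat) (p : 'rV[int]_N), (0 < q)%N /\ `|X *+ q - intmx R p| < e.
Proof.
move=> e0; pose fl n : 'rV[int]_N := \row_i Num.floor ((X *+ n) 0 i).
have [|w wP] := @bounded_seq_cluster (fun n => X *+ n - intmx R (fl n)).
  move=> n; apply: ler_norm_coord => // i; rewrite mxE [X in _ + X]mxE intmxE mxE.
  rewrite ger0_norm ?subr_ge0 ?floor_le // ltW //.
  by rewrite ltrBlDl -[X in _ + X]/(1%:~R) -intrD floorD1_gt.
have e2 : 0 < e / 2 by rewrite divr_gt0.
have [m _ wm] := wP (e / 2) 0%N e2; have [n mn wn] := wP (e / 2) m.+1 e2.
exists (n - m)%N, (fl n - fl m); split; first by rewrite subn_gt0.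
have -> : X *+ (n - m) - intmx R (fl n - fl m) =
    (w - (X *+ m - intmx R (fl m))) - (w - (X *+ n - intmx R (fl n))).
  set u := X *+ m - _; set v := X *+ n - _.
  rewrite [X in _ = _ + X]opprB [RHS]addrC addrA subrK {}/u {}/v.
  by rewrite mulrnBr 1?ltnW // intmxB !opprB addrACA [RHS]addrACA [X in _ + X]addrC.
rewrite [ltRHS]splitr.
by rewrite (le_lt_trans (ler_normB _ _)) // ltrD.
Qed.

(** A span [W s] of integer vectors of [k] of largest dimension contains all integer vectors of [k].
    For [X] in [k], some [X *+ q - p] is short and lies in [L], hence in [k]; so [p] is in [W s],
    and the component of [X] transverse to [W s] is arbitrarily small. *)
Lemma lines_rational L k : closed L -> (forall X Y, L X -> L Y -> L (X - Y)) ->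
  (forall p, L (intmx R p)) ->
  (forall X, X \in k <-> forall t, L (t *: X)) ->
  exists d (B : 'M[int]_(d, N)),
    forall X, X \in k <-> exists c : 'rV[R]_d, X = c *m intmx R B.
Proof.
move=> Lcl LB Lint hk.
have [e e0 small] := small_mem_lines Lcl LB hk.
pose good (s : seq 'rV[int]_N) := all [pred p | intmx R p \in k] s.
pose W (s : seq 'rV[int]_N) := <<map (@intmx R 1 N) s>>%VS.
pose attained n := `[< exists2 s, good s & \dim (W s) = n >].
have ex0 : exists n, attained n by exists (\dim (W [::])); apply/asboolP; exists [::].
have bd n : attained n -> (n <= \dim (fullv : {vspace 'rV[R]_N}))%N.
  by move=> /asboolP[s _ <-]; rewrite dimvS ?subvf.
have [n /asboolP[s gs ds] nmax] := ex_maxnP ex0 bd.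
have intW p : intmx R p \in k -> intmx R p \in W s.
  move=> pk; have : (\dim (W (p :: s)) <= \dim (W s))%N.
    by rewrite ds; apply: nmax; apply/asboolP; exists (p :: s); rewrite /= ?pk.
  rewrite /W /= span_cons => le.
  have : (W s == <[intmx R p]> + W s)%VS by rewrite eqEdim addvSr.
  by move=> /eqP eW; rewrite -/(W s) eW -[X in X \in _]addr0 memv_add ?memv_line ?mem0v.
have Wk : (W s <= k)%VS.
  by apply/span_subvP => _ /mapP[p ps ->]; move/allP: gs => /(_ p ps).
have kW X : X \in k -> X \in W s.
  move=> Xk; have [C C0 fC] := lfun_bounded (\1 - projv (W s))%VF.
  suff : (\1 - projv (W s))%VF X = 0.
    by rewrite add_lfunE opp_lfunE id_lfunE => /eqP; rewrite subr_eq0 => /eqP ->; exact: memv_proj.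
  apply: norm_eq0_eps => d d0.
  (* The bound [e] puts the difference in [k]; the bound [d / C] makes its transverse component
     smaller than [d]. *)
  have [|q [p [q0 qp]]] := @simultaneous_approx X (Num.min e (d / C)).
    by rewrite lt_min e0 divr_gt0.
  move: qp; rewrite lt_min => /andP[qpe qpd].
  have qXk : X *+ q \in k by rewrite rpredMn.
  have kL Y : Y \in k -> L Y by move=> /hk/(_ 1); rewrite scale1r.
  have dk : X *+ q - intmx R p \in k by apply: small => //; apply/LB/Lint/kL.
  have pk : intmx R p \in k by rewrite -(subKr (X *+ q) (intmx R p)) memvB.
  have eqd : (\1 - projv (W s))%VF (X *+ q - intmx R p) =
      (\1 - projv (W s))%VF X *+ q.
    rewrite linearB linearMn /= [X in _ - X](_ : _ = 0) ?subr0 //.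
    by rewrite add_lfunE opp_lfunE id_lfunE projv_id ?intW ?subrr.
  apply: (@le_lt_trans _ _ `|(\1 - projv (W s))%VF X *+ q|).
    by rewrite normrMn -mulr_natr ler_peMr // ler1n.
  by rewrite -eqd (le_lt_trans (fC _)) // mulrC -ltr_pdivlMr.
exists (size s), (\matrix_i nth 0 s i) => X.
have -> : X \in k <-> X \in W s by split=> [/kW//|]; exact: (subvP Wk).
have rowE (c : 'rV[R]_(size s)) : c *m intmx R (\matrix_i nth 0 s i) =
    \sum_i c 0 i *: (map (@intmx R 1 N) s)`_i.
  rewrite mulmx_sum_row; apply: eq_bigr => i _; congr (_ *: _).
  apply/rowP => j; rewrite (nth_map 0) //.
  by rewrite mxE !intmxE mxE.
split=> [XW|[c ->]]; last first.
  rewrite rowE; apply: memv_suml => i _; apply/memvZ/memv_span/mem_nth.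
  by rewrite size_map.
exists (\row_i coord (in_tuple (map (@intmx R 1 N) s))
   (cast_ord (esym (size_map _ _)) i) X).
rewrite rowE [LHS](@coord_span _ _ _ (in_tuple (map (@intmx R 1 N) s))) //.
rewrite (reindex (cast_ord (esym (size_map (@intmx R 1 N) s)))) /=; last first.
  exists (cast_ord (size_map (@intmx R 1 N) s)) => i _; [exact: cast_ordKV|].
  exact: cast_ordK.
by apply: eq_bigr => i _; rewrite mxE.
Qed.

End ClosedSubgroups.

(** * The exponential of the complex torus *)

Section ComplexExponential.
Variable R : realType.

Definition texp (z : R[i]) : R[i] := cexp (twopii R * z).

Lemma texpD x y : texp (x + y) = texp x * texp y.
Proof. by rewrite /texp mulrDr cexpD. Qed.

Lemma texp0 : texp 0 = 1.
Proof. by rewrite /texp mulr0 cexp0. Qed.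

Lemma texp_neq0 x : texp x != 0.
Proof. exact: cexp_neq0. Qed.

Lemma texpN x : texp (- x) = (texp x)^-1.
Proof.
by apply: (mulfI (texp_neq0 x)); rewrite -texpD subrr texp0 mulfV ?texp_neq0.
Qed.

Lemma texp_int (n : int) : texp n%:~R = 1.
Proof. by rewrite /texp -[n%:~R](rmorph_int (real_complex R)) cexp_twopii_int. Qed.

Lemma texp_sum (I : finType) (P : {pred I}) (f : I -> R[i]) :
  texp (\sum_(i in P) f i) = \prod_(i in P) texp (f i).
Proof. exact: (big_morph texp texpD texp0). Qed.

Lemma texpMn x n : texp (x *+ n) = texp x ^+ n.
Proof. by elim: n => [|n IH]; rewrite ?mulr0n ?texp0 // mulrS exprS texpD IH. Qed.

Lemma texp_real (t : R) : texp t%:C = (cos (2 * pi * t)) +i* (sin (2 * pi * t)).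
Proof.
by rewrite /texp /twopii /cexp /= !mul0r mulr0 subr0 add0r expR0 !mul1r.
Qed.

Lemma texp_imag (t : R) : texp ('i * t%:C) = (expR (- (2 * pi * t)))%:C.
Proof.
rewrite /texp /twopii /cexp /= !(mul0r, mul1r, mulr0, subr0, sub0r, addr0, add0r).
by rewrite oppr0 mulr0 cos0 sin0 mulr1 mulr0.
Qed.

(** Polar form: the real part of the logarithm carries the argument, found by [acos] up to the sign
    of the imaginary part, and its imaginary part carries the modulus. *)
Lemma texp_surj (b : R[i]) : b != 0 -> exists z, b = texp z.
Proof.
move=> b0; pose r := complex.Re `|b|.
have rE : `|b| = r%:C by rewrite /r RRe_real // normr_real.
have r0 : 0 < r by rewrite -(ltcR 0 r) -rE normr_gt0.
have rn0 : r%:C != 0 :> R[i] by rewrite -rE normr_eq0.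
suff [t bE] : exists t : R, b / r%:C = (cos t) +i* (sin t).
  exists ((t / (2 * pi))%:C + 'i * (- ln r / (2 * pi))%:C).
  have p0 : 2 * pi != 0 :> R by rewrite mulf_neq0 ?pnatr_eq0 // gt_eqF ?pi_gt0.
  have pK u : 2 * pi * (u / (2 * pi)) = u :> R by rewrite mulrC divfK.
  by rewrite texpD texp_real texp_imag !pK opprK lnK ?posrE // -bE divfK.
have n1 : `|b / r%:C| = 1 by rewrite normrM normfV -rE normr_id divff // rE.
case: (b / r%:C) n1 => x y; rewrite normc_def /= => -[/(congr1 (fun z => z ^+ 2))].
rewrite sqr_sqrtr ?addr_ge0 ?sqr_ge0 // expr1n => xy.
have x1 : -1 <= x <= 1.
  by rewrite -ler_norml -sqrtr_sqr -[leRHS]sqrtr1 ler_sqrt ?ltr01 // -xy lerDl sqr_ge0.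
have sE : sin (acos x) = `|y|.
  by rewrite sin_acos // -xy addrAC subrr add0r sqrtr_sqr.
have [y0|y0] := leP 0 y.
  by exists (acos x); rewrite acosK // sE ger0_norm.
by exists (- acos x); rewrite cosN sinN acosK // sE ltr0_norm // opprK.
Qed.

Lemma torus_expE N (X : 'rV[R[i]]_N) i : torus_exp X 0 i = texp (X 0 i).
Proof. exact: mxE. Qed.

End ComplexExponential.

(** * Continuity of the torus exponential *)

Section Continuity.
Variable R : realType.

Lemma cvg_row (U : topologicalType) (N : nat) (T : Type) (F : set_system T)
    (f : T -> 'rV[U]_N) (l : 'rV[U]_N) : Filter F ->
  (forall i, f x 0 i @[x --> F] --> l 0 i) -> f x @[x --> F] --> l.
Proof.
move=> FF fl A [P nP sA]; apply: (@filterS _ F _ (fun x => forall i, P 0 i (f x 0 i))).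
  by move=> x Px; apply: sA => i j; rewrite ord1.
by apply: filter_forall => i; apply: fl.
Qed.

Lemma row_coord_continuous (U : topologicalType) (N : nat) i :
  continuous (fun X : 'rV[U]_N => X 0 i).
Proof.
move=> X A nA; exists (fun i' j => if j == i then A else setT).
  move=> i' j; rewrite ord1; case: eqP => [->|_] //; exact: filterT.
by move=> Y /(_ 0 i); rewrite eqxx.
Qed.

Lemma real_complex_continuous : continuous (fun x : R => x%:C : R[i]^o).
Proof.
move=> x; apply/cvgrPdist_lt => e; case: e => e ei /= /andP[/eqP ei0 e0].
near=> y; rewrite -rmorphB /= normc_def /= expr0n addr0 sqrtr_sqr ei0 ltcR.
by near: y; exact: (@cvgr_dist_lt _ _ _ _ _ id x).
Unshelve. all: by end_near. Qed.

Lemma texp_real_continuous : continuous (fun t : R => texp t%:C : R[i]^o).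
Proof.
rewrite (_ : (fun t => _) = (fun t : R =>
    (cos (2 * pi * t))%:C + 'i * (sin (2 * pi * t))%:C : R[i]^o)); last first.
  by apply/funext => u; rewrite texp_real [LHS]complexE.
have cc (f : R -> R) : continuous f ->
    continuous (fun t => (f (2 * pi * t))%:C : R[i]^o).
  move=> cf t.
  apply: (@continuous_comp _ _ _ (fun t : R => 2 * pi * t) (fun t => (f t)%:C : R[i]^o)).
    by apply: cvgMl_tmp.
  by apply: (continuous_comp (cf _)); exact: real_complex_continuous.
move=> t; apply: (@cvgD _ R[i]^o); first exact/cc/continuous_cos.
by apply: (@cvgM R[i]); [exact: cvg_cst|exact/cc/continuous_sin].
Qed.

Lemma torus_exp_continuous (N : nat) :
  continuous (fun X : 'rV[R]_N => torus_exp (toC X) : rVtop R N).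
Proof.
move=> X; apply: (@cvg_row _ _ _ _ _ _ (nbhs_filter X)) => i.
rewrite torus_expE mxE.
rewrite (_ : (fun Y => _) = (fun t : R => texp t%:C) \o (fun Y : 'rV[R]_N => Y 0 i)).
  by apply: cvg_comp; [exact: row_coord_continuous|exact: texp_real_continuous].
by apply/funext => Y; rewrite torus_expE mxE.
Qed.

End Continuity.

(** * Rationality of the Lie algebra of a subtorus *)

Section Rationality.
Variables (R : realType) (N : nat).
Implicit Types X Y : 'rV[R[i]]_N.

Lemma torus_expB X Y : torus_exp (X - Y) = mulV (torus_exp X) (Defs.invV (torus_exp Y)).
Proof. by apply/rowP => i; rewrite !(mxE, torus_expE) texpD texpN. Qed.

(** The preimage of [K] under the exponential is a closed subgroup of [R^N] containing [Z^N], and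
    [k] is the union of the lines through 0 in it. *)
Lemma lie_algebra_rational (K : set 'rV[R[i]]_N) (k : {vspace 'rV[R]_N}) :
  subtorus K -> is_lie_algebra K k ->
  exists d (B : 'M[int]_(d, N)),
    forall X : 'rV[R]_N, X \in k <-> exists c : 'rV[R]_d, X = c *m intmx R B.
Proof.
move=> hK hk; apply: (@lines_rational _ _ [set X : 'rV[R]_N | K (torus_exp (toC X))]) hk.
- apply: (@closed_comp _ _ (fun X : 'rV[R]_N => torus_exp (toC X) : rVtop R N) K).
    by move=> X _; exact: torus_exp_continuous.
  exact: subtorus_closed hK.
- move=> X Y KX KY; rewrite /= [toC _]raddfB /= torus_expB.
  by apply: (subtorusM hK) => //; exact: (subtorusV hK).
- move=> p /=; have -> : torus_exp (toC (intmx R p)) = const_mx 1.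
    by apply/rowP => i; rewrite torus_expE !mxE rmorph_int texp_int.
  exact: subtorus1 hK.
Qed.

End Rationality.

(** * Closedness of images of tori *)

Section TorusImage.
Variable R : realType.

Lemma texpMz (x : R[i]) (n : int) : texp (x *~ n) = texp x ^ n.
Proof. by case: n => n; rewrite ?NegzE ?mulrNz ?texpN ?exprnN texpMn. Qed.

Lemma texp_eq1 (z : R[i]) : texp z = 1 -> exists n : int, z = n%:~R.
Proof. by case/cexp_twopii_eq1 => n ->; exists n; rewrite rmorph_int. Qed.

Lemma intmxM (F : pzRingType) m n p (A : 'M[int]_(m, n)) (B : 'M[int]_(n, p)) :
  intmx F (A *m B) = intmx F A *m intmx F B.
Proof. exact: map_mxM. Qed.

Lemma intmx1 (F : pzRingType) n : intmx F (1%:M : 'M[int]_n) = 1%:M.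
Proof. exact: map_mx1. Qed.

(* The columns of the inverse of the right Smith factor that meet a zero
   diagonal entry are the characters cutting out the image of the torus; they
   span a saturated lattice, so the image has no further components. *)
Lemma mem_torus_image (d M : nat) (G : 'M[int]_(d, M)) (P : {pred 'I_M})
    (b : 'I_M -> R[i]) : (forall j, j \in P -> b j != 0) ->
  (forall r : 'I_M -> int, (forall i, \sum_(j in P) G i j * r j = 0) ->
     \prod_(j in P) b j ^ r j = 1) ->
  exists c : 'rV[R[i]]_d, forall j, j \in P -> b j = texp ((c *m intmx _ G) 0 j).
Proof.
(* Columns of [G'] and logarithms [z] are set to 0 outside [P], so that sums over all coordinates
   reduce to sums over [P]. *)
move=> b0 bP; pose G' := \matrix_(i, j) (if j \in P then G i j else 0) : 'M[int]_(d, M).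
have [z zP] : exists z : 'rV[R[i]]_M, forall j,
    if j \in P then b j = texp (z 0 j) else z 0 j = 0.
  have [|z zP] := @choice 'I_M R[i] (fun j z => if j \in P then b j = texp z else z = 0).
    by move=> j; case: (boolP (j \in P)) => [/b0/texp_surj//|_]; exists 0.
  by exists (\row_j z j) => j; rewrite mxE; exact: zP.
have [L Lu [Q Qu [e _ GE]]] := int_Smith_normal_form G'.
set D := \matrix_(i, j) _ in GE.
pose u := z *m intmx _ (invmx Q).
(* Column [s] of the inverse of [Q] is then orthogonal to the rows of [G'], so [bP] applies to it
   and gives [texp (u 0 s) = 1]. *)
have uint s : (forall i, D i s = 0) -> exists n : int, u 0 s = n%:~R.
  move=> Ds; apply: texp_eq1; rewrite -[RHS](bP (fun j => invmx Q j s)).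
    rewrite mxE (bigID (mem P)) /= [X in _ + X]big1 ?addr0 => [|j jP]; last first.
      by have := zP j; rewrite (negPf jP) => ->; rewrite mul0r.
    rewrite texp_sum; apply: eq_bigr => j jP; have := zP j; rewrite jP => ->.
    by rewrite -texpMz intmxE mulrzr.
  move=> i; have : (G' *m invmx Q) i s = 0.
    rewrite GE -mulmxA mulmxV // mulmx1 mxE big1 // => j _.
    by rewrite Ds mulr0.
  rewrite mxE (bigID (mem P)) /= [X in _ + X]big1 ?addr0 => [es|j jP]; last first.
    by rewrite mxE (negPf jP) mul0r.
  by rewrite -[RHS]es; apply: eq_bigr => j jP; rewrite mxE jP.
have [|n nP] := @choice 'I_M int (fun s n => if [forall i, D i s == 0]
    then u 0 s = n%:~R else n = 0).
  move=> s; case: (boolP [forall i, _]) => [/forallP Ds|_]; last by exists 0.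
  by apply: uint => i; apply/eqP.
(* Solves [y *m D = u - n] by division along the diagonal, with 0 for rows beyond the last column.
   The integer shift [n] clears the coordinates outside the image of [D] and is killed by [texp]. *)
pose y : 'rV[R[i]]_d :=
  \row_i (if insub (i : nat) is Some s then u 0 s / (e`_i)%:~R else 0).
have yD : y *m intmx _ D = u - intmx _ (\row_s n s).
  apply/rowP => s; rewrite [LHS]mxE [RHS]mxE [X in _ + X]mxE intmxE [X in X%:~R]mxE.
  have := nP s; case: ifP => [/forallP Ds|].
    move=> ->; rewrite subrr big1 // => i _.
    by rewrite intmxE (eqP (Ds i)) mulr0.
  move=> /negbT; rewrite negb_forall => /existsP[i Di] ->.
  rewrite [X in _ - X]mulr0z subr0.
  have {}Di : (i == s :> nat) && (e`_i != 0).
    by move: Di; rewrite mxE; case: (nat_of_ord i == s) => //=; rewrite mulr0n eqxx.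
  case/andP: Di => /eqP si ei; rewrite (bigD1 i) //= [X in _ + X]big1 => [|i' i'i].
    rewrite addr0 intmxE [y 0 i]mxE [D i s]mxE insubT ?si // => sM; rewrite (_ : Sub _ _ = s); last exact: val_inj.
    by rewrite eqxx mulr1n -si divfK // intr_eq0.
  by rewrite intmxE !mxE -si (inj_eq val_inj) (negPf i'i) mulr0n mulr0.
exists (y *m intmx _ (invmx L)) => j jP.
have -> : (y *m intmx _ (invmx L) *m intmx R[i] G) 0 j =
    (y *m intmx _ (invmx L) *m intmx R[i] G') 0 j.
  rewrite [LHS]mxE [RHS]mxE; apply: eq_bigr => i _.
  by rewrite !intmxE [G' i j]mxE jP.
rewrite GE !intmxM !mulmxA -(mulmxA y) -intmxM mulVmx // intmx1 mulmx1.
rewrite yD mulmxBl /u -mulmxA -!intmxM mulVmx // intmx1 mulmx1.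
rewrite mxE [X in _ + X]mxE intmxE texpD texpN texp_int invr1 mulr1.
by have := zP j; rewrite jP.
Qed.

End TorusImage.

(** * Lattice coordinates on the torus *)

Section MinkowskiSums.
Variables (R : realType) (V : lmodType R).

(** The coefficient set [D] is arbitrary so that the nonnegative and the positive cones are treated
    at once. A list without repetition lets the coefficient at its head be redefined freely. *)
Lemma minkowski_bigP (D : set R) (I : eqType) (r : seq I) (v : I -> V) (w : V) :
  D !=set0 -> uniq r ->
  (\big[@minkowski_sum R V/[set 0]]_(i <- r) [set c *: v i | c in D]) w <->
  exists2 c : I -> R, forall i, D (c i) & w = \sum_(i <- r) c i *: v i.
Proof.
case=> d0 Dd0; elim: r w => [|i r IH] w.
  rewrite !big_nil; split=> [->|[c _ ->]]; last by rewrite big_nil.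
  by exists (fun=> d0); rewrite ?big_nil.
rewrite !big_cons /= => /andP[ir ur]; split.
  case=> _ [t Dt <-] [u /(IH u ur)[c Dc ->] <-].
  exists (fun j => if j == i then t else c j) => [j|]; first by case: eqP.
  rewrite big_cons eqxx; congr (_ + _); apply: eq_big_seq => j jr.
  by case: eqP => // ji; rewrite -ji jr in ir.
case=> c Dc; rewrite big_cons => ->; exists (c i *: v i); first by exists (c i).
by exists (\sum_(j <- r) c j *: v j) => //; apply/(IH _ ur); exists c.
Qed.

End MinkowskiSums.

Section Coordinates.
Variables (R : realType) (N : nat).
Implicit Types x y : HN R N.

Definition hcoord x (j : 'I_(N + N)) : R[i] := row_mx x.1 x.2 0 j.

Lemma hcoord_inj x y : hcoord x =1 hcoord y -> x = y.
Proof.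
case: x y => [x1 x2] [y1 y2] h; congr (_, _); apply/rowP => i.
  by have := h (lshift N i); rewrite /hcoord !row_mxEl.
by have := h (rshift N i); rewrite /hcoord !row_mxEr.
Qed.

Lemma polyevalE (f : mpoly.mpoly (N + N) R[i]) x : polyeval f x = mpoly.meval (hcoord x) f.
Proof. by []. Qed.

(** The torus scales [w_i] by the inverse of its factor on [z_i], hence the opposite weights in the
    second half. *)
Definition weights d (B : 'M[int]_(d, N)) : 'M[int]_(d, N + N) := row_mx B (- B).

Definition act d (B : 'M[int]_(d, N)) (c : 'rV[R[i]]_d) x : HN R N :=
  torus_act x (torus_exp (c *m intmx _ B)).

Lemma hcoord_act d (B : 'M[int]_(d, N)) (c : 'rV[R[i]]_d) x j :
  hcoord (act B c x) j = hcoord x j * texp ((c *m intmx _ (weights B)) 0 j).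
Proof.
rewrite /act /weights {2}/intmx map_row_mx -/(intmx _ B) mul_mx_row /hcoord /torus_act /=.
case: (split_ordP j) => i ->; rewrite ?row_mxEl ?row_mxEr.
  by rewrite mxE torus_expE.
rewrite mxE [X in _ * X]mxE torus_expE -texpN; congr (_ * texp _).
by rewrite raddfN mulmxN [RHS]mxE.
Qed.

End Coordinates.

(** * Semistability and cones in lattice coordinates *)

Section Dictionary.
Variables (R : realType) (N d : nat) (k : {vspace 'rV[R]_N}) (B : 'M[int]_(d, N)).
Hypothesis kB : forall X, X \in k <-> exists c : 'rV[R]_d, X = c *m intmx R B.

Lemma ReV_mulmx (c : 'rV[R[i]]_d) m (A : 'M[int]_(d, m)) :
  Defs.ReV (c *m intmx _ A) = Defs.ReV c *m intmx _ A.
Proof.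
apply/rowP => j; rewrite !mxE raddf_sum; apply: eq_bigr => r _.
rewrite !mxE -(rmorph_int (real_complex R)).
by case: (c 0 r) => u v /=; rewrite mulr0 subr0.
Qed.

Lemma ImV_mulmx (c : 'rV[R[i]]_d) m (A : 'M[int]_(d, m)) :
  Defs.ImV (c *m intmx _ A) = Defs.ImV c *m intmx _ A.
Proof.
apply/rowP => j; rewrite !mxE raddf_sum; apply: eq_bigr => r _.
rewrite !mxE -(rmorph_int (real_complex R)).
by case: (c 0 r) => u v /=; rewrite mulr0 add0r.
Qed.

Lemma mem_complexify X :
  X \in complexify k <-> exists c : 'rV[R[i]]_d, X = c *m intmx _ B.
Proof.
split=> [/complexifyP[/kB[u uE] /kB[v vE]]|[c ->]]; last first.
  by apply/complexifyP; rewrite ReV_mulmx ImV_mulmx; split; apply/kB; eexists.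
exists (toC u + 'i *: toC v).
transitivity (toC (Defs.ReV X) + 'i *: toC (Defs.ImV X)).
  by apply/rowP => j; rewrite !mxE [LHS]complexE.
rewrite uE vE mulmxDl -scalemxAl; congr (_ + _ *: _);
  by apply/rowP => j; rewrite !mxE rmorph_sum; apply: eq_bigr => r _;
     rewrite !mxE rmorphM rmorph_int.
Qed.

Lemma KCP b : KC k b <-> exists c : 'rV[R[i]]_d, b = torus_exp (c *m intmx _ B).
Proof.
split=> [[X /mem_complexify[c ->] <-]|[c ->]]; first by exists c.
by exists (c *m intmx _ B) => //; apply/mem_complexify; exists c.
Qed.

Lemma int_row_mem r : intmx R (row r B) \in k.
Proof.
apply/kB; exists (delta_mx 0 r); rewrite -rowE.
by apply/rowP => j; rewrite !mxE.
Qed.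

(** Coordinates on the dual of [k]: the rows of [B] span [k], so these values determine the
    functional, and they are integers when it is integral. *)
Definition lattice_values (f : dual_space k) : 'cV[R]_d :=
  \col_r f (vsproj k (intmx R (row r B))).

Lemma lattice_values_is_linear : linear lattice_values.
Proof. by move=> t f g; apply/colP => r; rewrite !mxE !lfunE /= lfunE. Qed.

HB.instance Definition _ := GRing.isLinear.Build R (dual_space k) 'cV[R]_d *:%R
  lattice_values lattice_values_is_linear.

Lemma dual_eval (f : dual_space k) (c : 'rV[R]_d) :
  f (vsproj k (c *m intmx R B)) = (c *m lattice_values f) 0 0.
Proof.
rewrite mulmx_sum_row !linear_sum mxE; apply: eq_bigr => r _.
rewrite !linearZ /= mxE; congr (_ * f (vsproj k _)).
by apply/rowP => j; rewrite !mxE.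
Qed.

Lemma lattice_values_inj : injective lattice_values.
Proof.
move=> f g fg; apply/lfunP => X.
have [c Xc] := (kB (vsval X)).1 (subvsP X).
by rewrite -(vsvalK X) Xc !dual_eval fg.
Qed.

Lemma lattice_values_basis i :
  lattice_values (iota_dual k (dual_basis R i)) = intmx R (col i B).
Proof.
apply/colP => r; rewrite mxE iota_dualE vsprojK ?int_row_mem //.
by rewrite !mxE.
Qed.

Lemma integral_lattice_values (alpha : dual_space k) : integral_dual alpha ->
  exists a : 'cV[int]_d, lattice_values alpha = intmx R a.
Proof.
move=> alphaZ.
have [|a aE] := @choice 'I_d int (fun r n =>
    alpha (vsproj k (intmx R (row r B))) = n%:~R).
  move=> r; apply/intrP/alphaZ => i.
  by rewrite vsprojK ?int_row_mem // intmxE intr_int.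
by exists (\col_r a r); apply/colP => r; rewrite intmxE !mxE.
Qed.

Variables (alpha : dual_space k) (a : 'cV[int]_d).
Hypothesis alphaZ : integral_dual alpha.
Hypothesis alpha_a : lattice_values alpha = intmx R a.

Lemma chi_texp (c : 'rV[R[i]]_d) :
  chi alpha (torus_exp (c *m intmx _ B)) = texp ((c *m intmx _ a) 0 0).
Proof.
rewrite chiE //; last by apply/mem_complexify; exists c.
rewrite /pairing ReV_mulmx ImV_mulmx !dual_eval alpha_a -ReV_mulmx -ImV_mulmx.
by rewrite /texp; congr (cexp (_ * _)); rewrite !mxE /=; case: (\sum_i _).
Qed.

Definition semi_invariant (m : nat) (f : mpoly.mpoly (N + N) R[i]) :=
  forall y c, polyeval f (act B c y) =
    polyeval f y * texp ((c *m intmx _ a) 0 0) ^+ m.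

Lemma semistableP x : semistable alpha x <->
  exists m f, [/\ (0 < m)%N, semi_invariant m f & polyeval f x != 0].
Proof.
split=> [[m [m0 [f [fP fx]]]]|[m [f [m0 fP fx]]]]; exists m.
  by exists f; split=> // y c; rewrite /act fP ?chi_texp //; apply/KCP; exists c.
split=> //; exists f; split=> // y _ /KCP[c ->].
by rewrite chi_texp; exact: fP.
Qed.

Lemma normsq_eq0 (z : R[i]) : (normsq z == 0) = (z == 0).
Proof. by case: z => u v; rewrite eq_complex paddr_eq0 ?sqr_ge0 // !sqrf_eq0. Qed.

Lemma normsq_ge0 (z : R[i]) : 0 <= normsq z.
Proof. by rewrite addr_ge0 ?sqr_ge0. Qed.

(** Unfolds to [cone_ge0] and [cone_gt0] when [D] is the set of nonnegative or of positive reals. *)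
Definition cone (D : set R) (x : HN R N) : set (dual_space k) :=
  minkowski_sum
    (\big[@minkowski_sum _ _/[set 0]]_(i < N)
       [set c *: (normsq (x.1 0 i) *: iota_dual k (dual_basis _ i)) | c in D])
    (\big[@minkowski_sum _ _/[set 0]]_(i < N)
       [set c *: (normsq (x.2 0 i) *: - iota_dual k (dual_basis _ i)) | c in D]).

(** The positive values of [normsq] are absorbed into the coefficients, [D] being stable under
    positive scaling. At a vanishing coordinate the generator is 0 and the coefficient gets the
    default value 1. *)
Lemma coneP (D : set R) x : D 1 ->
  (forall s t, 0 < s -> D t -> D (s * t)) ->
  cone D x alpha <-> exists2 c : 'I_(N + N) -> R, forall j, D (c j) &
    intmx R a = \sum_(j | hcoord x j != 0) c j *: intmx R (col j (weights B)).
Proof.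
move=> D1 DM; have D0 : D !=set0 by exists 1.
have colB i : intmx R (col (rshift N i) (weights B)) = - intmx R (col i B).
  by apply/colP => r; rewrite intmxE mxE /weights row_mxEr [RHS]mxE !mxE rmorphN.
have colBl i : intmx R (col (lshift N i) (weights B)) = intmx R (col i B).
  by apply/colP => r; rewrite !intmxE mxE /weights row_mxEl mxE.
have wsum (c : 'I_(N + N) -> R) :
    \sum_(j | hcoord x j != 0) (c j * normsq (hcoord x j)) *:
      intmx R (col j (weights B)) =
    lattice_values (\sum_(i < N) c (lshift N i) *:
        (normsq (x.1 0 i) *: iota_dual k (dual_basis _ i)) +
      \sum_(i < N) c (rshift N i) *:
        (normsq (x.2 0 i) *: - iota_dual k (dual_basis _ i))).
  rewrite big_mkcond big_split_ord /= linearD !linear_sum; congr (_ + _).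
    apply: eq_bigr => i _; rewrite /hcoord row_mxEl 2!linearZ /= lattice_values_basis.
    rewrite colBl scalerA; case: eqP => //= ->.
    by rewrite (_ : normsq 0 = 0) ?mulr0 ?scale0r //; apply/eqP; rewrite normsq_eq0.
  apply: eq_bigr => i _; rewrite /hcoord row_mxEr 2!linearZ linearN /=.
  rewrite lattice_values_basis colB scalerA; case: eqP => //= ->.
  by rewrite (_ : normsq 0 = 0) ?mulr0 ?scale0r //; apply/eqP; rewrite normsq_eq0.
split.
  case=> _ /minkowski_bigP[//||c Dc ->]; first exact: index_enum_uniq.
  case=> _ /minkowski_bigP[//||e De ->]; first exact: index_enum_uniq.
  pose g (j : 'I_(N + N)) := match fintype.split j with inl i => c i | inr i => e i end.
  have gl i : g (lshift N i) = c i by rewrite /g (unsplitK (inl i)).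
  have gr i : g (rshift N i) = e i by rewrite /g (unsplitK (inr i)).
  move=> gE; exists (fun j => if hcoord x j == 0 then 1 else normsq (hcoord x j) * g j).
    move=> j; case: eqP => // /eqP xj; apply: DM.
      by rewrite lt_def normsq_eq0 xj normsq_ge0.
    by rewrite /g; case: fintype.split.
  rewrite -alpha_a -gE.
  rewrite (eq_bigr _ (fun i _ => congr1 (fun t => t *: _) (esym (gl i)))).
  rewrite [X in _ + X](eq_bigr _ (fun i _ => congr1 (fun t => t *: _) (esym (gr i)))).
  rewrite -wsum; apply: eq_bigr => j /negPf ->.
  by rewrite mulrC.
case=> c Dc aE.
pose c' j := if hcoord x j == 0 then 1 else (normsq (hcoord x j))^-1 * c j.
have Dc' j : D (c' j).
  rewrite /c'; case: eqP => // /eqP xj; apply: DM => //.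
  by rewrite invr_gt0 lt_def normsq_eq0 xj normsq_ge0.
exists (\sum_(i < N) c' (lshift N i) *:
        (normsq (x.1 0 i) *: iota_dual k (dual_basis _ i))).
  apply/(minkowski_bigP _ _ D0 (index_enum_uniq _)).
  by exists (fun i => c' (lshift N i)).
exists (\sum_(i < N) c' (rshift N i) *:
        (normsq (x.2 0 i) *: - iota_dual k (dual_basis _ i))).
  apply/(minkowski_bigP _ _ D0 (index_enum_uniq _)).
  by exists (fun i => c' (rshift N i)).
apply: lattice_values_inj; rewrite -wsum alpha_a aE.
apply: eq_bigr => j xj; rewrite /c' (negPf xj) mulrC mulrA mulfV ?mul1r //.
by rewrite normsq_eq0.
Qed.

End Dictionary.

(** * Topology of the quaternionic space *)

Section PolynomialContinuity.
Variables (R : realType) (T : topologicalType).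

Lemma continuous_sumC (I : Type) (r : seq I) (F : I -> T -> R[i]^o) :
  (forall i, continuous (F i)) -> continuous (fun x => \sum_(i <- r) F i x : R[i]^o).
Proof.
move=> cF; apply: (@continuous_big R[i]^o) => //.
exact: pseudometric_normed_Zmodule.add_continuous.
Qed.

Lemma continuous_mulC (f g : T -> R[i]^o) : continuous f -> continuous g ->
  continuous (fun x => f x * g x : R[i]^o).
Proof. by move=> cf cg x; apply: (@cvgM R[i]); [exact: cf|exact: cg]. Qed.

Lemma continuous_prodC (I : Type) (r : seq I) (P : pred I) (F : I -> T -> R[i]^o) :
  (forall i, continuous (F i)) ->
  continuous (fun x => \prod_(i <- r | P i) F i x : R[i]^o).
Proof.
move=> cF; apply: (@continuous_big R[i]^o) => //.
by move=> -[x y]; apply: (@cvgM R[i]); [exact: cvg_fst|exact: cvg_snd].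
Qed.

Lemma continuous_expC n (f : T -> R[i]^o) : continuous f ->
  continuous (fun x => f x ^+ n : R[i]^o).
Proof.
move=> cf; elim: n => [|n IH]; first by move=> x; exact: cvg_cst.
rewrite (_ : (fun _ => _) = (fun x => f x * f x ^+ n : R[i]^o)).
  exact: continuous_mulC.
by apply/funext => x; rewrite exprS.
Qed.

Lemma continuous_cstC (z : R[i]) : continuous (fun _ : T => z : R[i]^o).
Proof. by move=> x; exact: cvg_cst. Qed.

Lemma closure_eq_continuous (A : set T) (f g : T -> R[i]^o) y :
  continuous f -> continuous g -> (forall x, A x -> f x = g x) ->
  closure A y -> f y = g y.
Proof.
move=> cf cg fg Ay; apply/eqP; rewrite -subr_eq0; apply/eqP.
have cl : closed [set x | f x - g x = 0].
  apply: (@closed_comp _ _ (fun x => f x - g x : R[i]^o) [set 0]).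
    by move=> x _; apply: (@cvgB _ R[i]^o); [exact: cf|exact: cg].
  by apply: accessible_closed_set1; apply: hausdorff_accessible; exact: norm_hausdorff.
apply: (cl y); apply: closureS Ay => x /fg /= ->; exact: subrr.
Qed.

End PolynomialContinuity.

Section HyperkahlerTopology.
Variables (R : realType) (N : nat).

Lemma hcoord_continuous j : continuous (fun x : HNtop R N => hcoord x j : R[i]^o).
Proof.
case: (split_ordP j) => i -> {j} x.
  rewrite (_ : (fun x => _) = (fun v : 'rV[R[i]^o]_N => v 0 i) \o fst).
    by apply: (continuous_comp cvg_fst); exact: row_coord_continuous.
  by apply/funext => y; rewrite /hcoord row_mxEl.
rewrite (_ : (fun x => _) = (fun v : 'rV[R[i]^o]_N => v 0 i) \o snd).
  by apply: (continuous_comp cvg_snd); exact: row_coord_continuous.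
by apply/funext => y; rewrite /hcoord row_mxEr.
Qed.

Lemma cvg_hcoord (T : Type) (F : set_system T) (f : T -> HNtop R N) (l : HNtop R N) :
  Filter F -> (forall j, (hcoord (f t) j : R[i]^o) @[t --> F] --> (hcoord l j : R[i]^o)) ->
  f t @[t --> F] --> l.
Proof.
move=> FF fl; case: l fl => l1 l2 fl.
rewrite (_ : f = fun t => ((f t).1, (f t).2)); last first.
  by apply/funext => t; case: (f t).
have c1 : (fun t => (f t).1) @ F --> (l1 : 'rV[R[i]^o]_N).
  apply: cvg_row => i; have := fl (lshift N i); rewrite /hcoord row_mxEl.
  by rewrite (_ : (fun t => _) = fun t => (f t).1 0 i) //; apply/funext => t; rewrite row_mxEl.
have c2 : (fun t => (f t).2) @ F --> (l2 : 'rV[R[i]^o]_N).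
  apply: cvg_row => i; have := fl (rshift N i); rewrite /hcoord row_mxEr.
  by rewrite (_ : (fun t => _) = fun t => (f t).2 0 i) //; apply/funext => t; rewrite row_mxEr.
exact: cvg_pair c1 c2.
Qed.

Lemma polyeval_continuous (f : mpoly.mpoly (N + N) R[i]) :
  continuous (fun x : HNtop R N => polyeval f x : R[i]^o).
Proof.
rewrite (_ : (fun x => _) = fun x : HNtop R N => \sum_(m <- mpoly.msupp f)
   mpoly.mcoeff m f * \prod_i hcoord x i ^+ mpoly.fun_of_multinom m i : R[i]^o).
  apply: continuous_sumC => m; apply: continuous_mulC; first exact: continuous_cstC.
  apply: continuous_prodC => i; apply: continuous_expC; exact: hcoord_continuous.
by apply/funext => x; rewrite polyevalE mpoly.mevalE.
Qed.

End HyperkahlerTopology.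

(** * One-parameter subgroups and their limits *)

Section OneParameter.
Variables (R : realType) (N d : nat) (B : 'M[int]_(d, N)).
Implicit Types (x y : HN R N) (X : 'rV[R]_d) (c : 'rV[R[i]]_d).

Let G := weights B.

Lemma weights_rshift (F : pzRingType) (c : 'rV[F]_d) i :
  (c *m intmx _ G) 0 (rshift N i) = - (c *m intmx _ G) 0 (lshift N i).
Proof.
rewrite [LHS]mxE [X in - X]mxE -sumrN; apply: eq_bigr => r _.
by rewrite !intmxE /G /weights row_mxEr row_mxEl mxE rmorphN mulrN.
Qed.

Lemma mul_intmx_col (F : pzRingType) (c : 'rV[F]_d) j :
  (c *m intmx _ (col j G)) 0 0 = (c *m intmx _ G) 0 j.
Proof. by rewrite !mxE; apply: eq_bigr => r _; rewrite !mxE. Qed.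

(** Imaginary multiples of [X] give a noncompact direction of the torus, in which a weight with
    value [w] at [X] acts by the positive real number [exp (- 2 pi n w)]. *)
Definition oneps X (n : nat) : 'rV[R[i]]_d := ('i * n%:R) *: toC X.

Lemma texp_oneps X n m (A : 'M[int]_(d, m)) j :
  texp ((oneps X n *m intmx _ A) 0 j) =
  (expR (- (2 * pi * (X *m intmx _ A) 0 j)) ^+ n)%:C.
Proof.
rewrite -expRM_natr -mulNr -mulrA mulNr -texp_imag rmorphM /= mulrCA; congr texp.
rewrite [LHS]mxE mxE rmorph_sum mulr_suml; apply: eq_bigr => r _.
by rewrite !mxE rmorphM !rmorph_int rmorph_nat; ring.
Qed.

Definition of_hcoord (v : 'I_(N + N) -> R[i]) : HN R N :=
  (\row_i v (lshift N i), \row_i v (rshift N i)).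

Lemma of_hcoordE v j : hcoord (of_hcoord v) j = v j.
Proof.
by case: (split_ordP j) => i ->; rewrite /hcoord ?row_mxEl ?row_mxEr mxE.
Qed.

(** Coordinates of weight 0 are fixed and those of positive weight tend to 0; under the hypothesis
    of [cvg_oneps], a coordinate of negative weight is already 0. *)
Definition oneps_limit X x :=
  of_hcoord (fun j => if (X *m intmx _ G) 0 j == 0 then hcoord x j else 0).

Lemma cvg_oneps X x :
  (forall j, hcoord x j != 0 -> 0 <= (X *m intmx _ G) 0 j) ->
  (act B (oneps X n) x : HNtop R N) @[n --> \oo] --> (oneps_limit X x : HNtop R N).
Proof.
move=> Xx; apply: cvg_hcoord => j; rewrite of_hcoordE.
rewrite (_ : (fun n => _) = fun n => hcoord x j *
    (expR (- (2 * pi * (X *m intmx _ G) 0 j)) ^+ n)%:C : R[i]^o); last first.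
  by apply/funext => n; rewrite hcoord_act texp_oneps.
have [x0|x0] := eqVneq (hcoord x j) 0.
  rewrite x0 if_same (_ : (fun n => _) = fun=> 0); first exact: cvg_cst.
  by apply/funext => n; rewrite mul0r.
case: eqVneq => [->|t0].
  rewrite (_ : (fun n => _) = fun=> hcoord x j : R[i]^o); first exact: cvg_cst.
  by apply/funext => n; rewrite mulr0 oppr0 expR0 expr1n mulr1.
have tp : 0 < (X *m intmx _ G) 0 j by rewrite lt_def t0 Xx.
rewrite -[X in _ --> X](mulr0 (hcoord x j)).
apply: (@cvgM R[i]); first exact: cvg_cst.
have q0 : expR (- (2 * pi * (X *m intmx _ G) 0 j)) ^+ n @[n --> \oo] --> (0 : R).
  apply: cvg_expr; rewrite ger0_norm ?expR_ge0 // expR_lt1 oppr_lt0.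
  by rewrite !mulr_gt0 ?pi_gt0.
by apply: (cvg_comp _ _ q0); exact: real_complex_continuous.
Qed.

End OneParameter.

(** * Invariance of the complex moment map *)

Section Invariance.
Variables (R : realType) (N d : nat) (k : {vspace 'rV[R]_N}) (B : 'M[int]_(d, N)).
Implicit Types (x y : HN R N).

Lemma muC_eq x y : (forall i, hcoord x (lshift N i) * hcoord x (rshift N i) =
    hcoord y (lshift N i) * hcoord y (rshift N i)) -> muC k x = muC k y.
Proof.
move=> xy; rewrite /muC; congr (_ *: _); apply: eq_bigr => i _; congr (_ *: _).
by have := xy i; rewrite /hcoord !row_mxEl !row_mxEr.
Qed.

Lemma muC_act c x : muC k (act B c x) = muC k x.
Proof.
apply: muC_eq => i; rewrite !hcoord_act mulrACA weights_rshift texpN.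
by rewrite mulfV ?texp_neq0 // mulr1.
Qed.

(** The weights at [z_i] and [w_i] are opposite, and nonnegative wherever the coordinate is nonzero;
    so if they are nonzero, [z_i w_i] is already 0 at [x]. *)
Lemma muC_oneps_limit (X : 'rV[R]_d) x :
  (forall j, hcoord x j != 0 -> 0 <= (X *m intmx _ (weights B)) 0 j) ->
  muC k (oneps_limit B X x) = muC k x.
Proof.
move=> Xx; apply: muC_eq => i; rewrite !of_hcoordE weights_rshift oppr_eq0.
case: eqP => // /eqP t0; rewrite mulr0; apply/esym/eqP; rewrite mulf_eq0.
apply: contraT; rewrite negb_or => /andP[/Xx tl /Xx].
by rewrite weights_rshift oppr_ge0 => tr; rewrite eq_le tl tr in t0.
Qed.

End Invariance.

(** * Semistability and closed orbits *)

Section Stability.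
Variables (R : realType) (N d : nat) (k : {vspace 'rV[R]_N}) (B : 'M[int]_(d, N)).
Hypothesis kB : forall X, X \in k <-> exists c : 'rV[R]_d, X = c *m intmx R B.
Variables (alpha : dual_space k) (a : 'cV[int]_d).
Hypothesis alphaZ : integral_dual alpha.
Hypothesis alpha_a : lattice_values B alpha = intmx R a.
Implicit Types (x y : HN R N) (c : 'rV[R[i]]_d).

Let G := weights B.
Let ssP := semistableP kB alphaZ alpha_a.
Let supp x := [pred j | hcoord x j != 0].

(** Otherwise Farkas' lemma gives [X] nonnegative on the weights in the support of [x] and negative
    on [a]. Along [oneps X] the point converges, so the value of a semi-invariant converges, while
    the inverse of its character tends to 0; hence it vanishes at [x]. *)
Lemma semistable_cone x : semistable alpha x ->
  exists2 c : 'I_(N + N) -> R, forall j, 0 <= c j &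
    intmx R a = \sum_(j in supp x) c j *: intmx R (col j G).
Proof.
move=> /ssP[m [f [m0 fP fx]]].
have [|c c0 ->] := @farkas _ _ _ (enum (supp x)) (fun j => intmx R (col j G))
    (intmx R a) (enum_uniq _); last by exists c; rewrite ?big_enum.
move=> X Xg; rewrite leNgt; apply/negP => Xa.
have Xx j : hcoord x j != 0 -> 0 <= (X *m intmx _ G) 0 j.
  by move=> xj; rewrite -mul_intmx_col Xg // mem_enum.
(* [q ^+ n] is the inverse of the character of weight [a] at [oneps X n], and [q < 1]. *)
pose q : R := expR (2 * pi * (X *m intmx R a) 0 0).
have qlim : (fun n => (q ^+ n)%:C : R[i]^o) @ \oo --> (0 : R[i]^o).
  apply: (cvg_comp _ _ (_ : (fun n => q ^+ n) @ \oo --> (0 : R))).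
    apply: cvg_expr; rewrite ger0_norm ?expR_ge0 // expR_lt1.
    by rewrite pmulr_rlt0 // mulr_gt0 ?pi_gt0.
  exact: real_complex_continuous.
have lim0 : (fun n => polyeval f (act B (oneps X n) x) * (q ^+ n)%:C ^+ m : R[i]^o)
    @ \oo --> (0 : R[i]^o).
  rewrite -[X in _ --> X](mulr0 (polyeval f (oneps_limit B X x))).
  apply: (@cvgM R[i]).
    apply: (cvg_comp _ _ (cvg_oneps Xx)); exact: polyeval_continuous.
  rewrite -[X in _ --> X](_ : 0 ^+ m = 0 :> R[i]); last by rewrite expr0n gtn_eqF.
  apply: (@cvg_comp _ _ _ _ (fun z : R[i]^o => z ^+ m : R[i]^o) _ _ _ qlim).
  by apply: (@continuous_expC R R[i]^o m id) => z; exact: cvg_id.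
move/eqP: fx; apply; apply/esym; apply: (cvg_unique (@norm_hausdorff _ R[i]^o) lim0).
rewrite (_ : (fun n => _) = fun=> polyeval f x : R[i]^o); first exact: cvg_cst.
apply/funext => n; rewrite fP texp_oneps -mulrA -exprMn -rmorphM -exprMn.
by rewrite /q -expRD addNr expR0 expr1n rmorph1 expr1n mulr1.
Qed.

Definition monomial (P : {pred 'I_(N + N)}) (n : 'I_(N + N) -> nat) :
    mpoly.mpoly (N + N) R[i] :=
  mpoly.mpolyX _ (mpoly.Multinom [tuple (if j \in P then n j else 0%N) | j < N + N]).

Lemma polyeval_monomial P n y :
  polyeval (monomial P n) y = \prod_(j in P) hcoord y j ^+ n j.
Proof.
rewrite polyevalE mpoly.mevalX [RHS]big_mkcond; apply: eq_bigr => j _.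
by rewrite mpoly.multinomE tnth_mktuple; case: ifP.
Qed.

Lemma monomial_semi_invariant P n m : a *+ m = \sum_(j in P) col j G *+ n j ->
  semi_invariant B a m (monomial P n).
Proof.
move=> an y c; rewrite !polyeval_monomial -texpMn.
rewrite (_ : _ *+ m = \sum_(j in P) (c *m intmx _ G) 0 j *+ n j).
  rewrite texp_sum -big_split; apply: eq_bigr => j _.
  by rewrite hcoord_act exprMn texpMn.
have intMn (v : 'cV[int]_d) (p : nat) :
    (c *m map_mx intr (v *+ p)) 0 0 = (c *m intmx R[i] v) 0 0 *+ p.
  by rewrite raddfMn /= -scaler_nat -scalemxAr mxE mulr_natl.
rewrite -intMn an raddf_sum mulmx_sumr summxE; apply: eq_bigr => j _.
by rewrite intMn mul_intmx_col.
Qed.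

(** The exponents from [nat_cone] give a monomial of weight [a *+ m] in the nonzero coordinates of
    [x]. *)
Lemma cone_semistable x (c : 'I_(N + N) -> R) : (forall j, 0 <= c j) ->
  intmx R a = \sum_(j in supp x) c j *: intmx R (col j G) -> semistable alpha x.
Proof.
move=> c0 /(nat_cone c0)[m [n [m0 an _]]]; apply/ssP.
exists m, (monomial (supp x) n); split=> //; first exact: monomial_semi_invariant.
rewrite polyeval_monomial; apply/prodf_neq0 => j; rewrite inE => xj.
exact: expf_neq0.
Qed.

Lemma semistable_act c x : semistable alpha x -> semistable alpha (act B c x).
Proof.
move=> /ssP[m [f [m0 fP fx]]].
apply/ssP; exists m, f; split=> //.
by rewrite fP mulf_neq0 // expf_neq0 // texp_neq0.
Qed.

Lemma KC_orbitP x y : KC_orbit k x y <-> exists c, y = act B c x.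
Proof.
split=> [[_ /(KCP kB)[c ->] <-]|[c ->]]; first by exists c.
by exists (torus_exp (c *m intmx _ B)) => //; apply/(KCP kB); exists c.
Qed.

(** The character is trivial along [oneps X], so a semi-invariant is constant there and keeps its
    nonzero value in the limit. *)
Lemma semistable_oneps_limit (X : 'rV[R]_d) x :
  (forall j, hcoord x j != 0 -> 0 <= (X *m intmx _ G) 0 j) ->
  (X *m intmx _ a) 0 0 = 0 -> semistable alpha x ->
  semistable alpha (oneps_limit B X x).
Proof.
move=> Xx Xa /ssP[m [f [m0 fP fx]]].
apply/ssP; exists m, f; split=> //.
suff <- : polyeval f x = polyeval f (oneps_limit B X x) by [].
have lim : (fun n => polyeval f (act B (oneps X n) x) : R[i]^o) @ \oo -->
    (polyeval f (oneps_limit B X x) : R[i]^o).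
  apply: (cvg_comp _ _ (cvg_oneps Xx)); exact: polyeval_continuous.
apply: (cvg_unique (@norm_hausdorff _ R[i]^o) _ lim).
rewrite (_ : (fun n => _) = fun=> polyeval f x : R[i]^o); first exact: cvg_cst.
apply/funext => n; rewrite fP texp_oneps Xa mulr0 oppr0 expR0 expr1n.
by rewrite rmorph1 expr1n mulr1.
Qed.

(** Without positive coefficients, Motzkin's alternative moves [x] to a semistable limit in the same
    fibre of [muC]. Closedness puts this limit in the orbit, but it has lost a nonzero coordinate of
    [x]. *)
Lemma closed_orbit_cone beta x : muC_ss beta alpha x ->
  closed_in (muC_ss beta alpha) (KC_orbit k x) ->
  exists2 c : 'I_(N + N) -> R, forall j, 0 < c j &
    intmx R a = \sum_(j in supp x) c j *: intmx R (col j G).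
Proof.
move=> [xbeta xss] [F Fcl orbE].
have [c c0 aE] := semistable_cone xss.
have [[c' c'0 cE]|[X [Xg Xa [j jx Xj]]]] :=
    motzkin (supp x) (fun j => intmx R (col j G)) c0.
  by exists c' => //; rewrite aE.
exfalso; rewrite -aE in Xa.
have Xx i : hcoord x i != 0 -> 0 <= (X *m intmx _ G) 0 i.
  by move=> xi; rewrite -mul_intmx_col Xg.
have : (muC_ss beta alpha `&` F) (oneps_limit B X x).
  split.
    by split; [rewrite muC_oneps_limit|exact: semistable_oneps_limit].
  apply: (closed_cvg _ Fcl _ _ (cvg_oneps Xx)); apply: nearW => n.
  suff : (muC_ss beta alpha `&` F) (act B (oneps X n) x) by case.
  by rewrite -orbE; apply/KC_orbitP; exists (oneps X n).
rewrite -orbE => /KC_orbitP[e] /(congr1 (fun y => hcoord y j)).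
rewrite of_hcoordE hcoord_act -mul_intmx_col gt_eqF // => /esym/eqP.
by rewrite mulf_eq0 (negPf jx) (negPf (texp_neq0 _)).
Qed.

(** * Equations that persist on the closure of an orbit *)

Section ClosureEquations.
Variables (x y : HN R N).
Hypothesis yx : closure (KC_orbit k x : set (HNtop R N)) y.

Lemma closure_orbit_eq (f g : HNtop R N -> R[i]^o) : continuous f -> continuous g ->
  (forall c, f (act B c x) = g (act B c x)) -> f y = g y.
Proof.
move=> cf cg fg; apply: closure_eq_continuous cf cg _ yx.
by move=> _ /KC_orbitP[c ->].
Qed.

Lemma closure_orbit_supp j : hcoord x j = 0 -> hcoord y j = 0.
Proof.
move=> xj; apply: (closure_orbit_eq (@hcoord_continuous R N j) (@continuous_cstC _ _ 0)).
by move=> c; rewrite hcoord_act xj mul0r.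
Qed.

(* Powers of two semi-invariants with equal weights are proportional on the
   orbit, hence on its closure. *)
Lemma closure_orbit_semi_invariant m f m' f' :
  semi_invariant B a m f -> semi_invariant B a m' f' ->
  polyeval f y ^+ m' * polyeval f' x ^+ m = polyeval f x ^+ m' * polyeval f' y ^+ m.
Proof.
move=> fP f'P.
apply: (closure_orbit_eq (f := fun y => polyeval f y ^+ m' * polyeval f' x ^+ m)
  (g := fun y => polyeval f x ^+ m' * polyeval f' y ^+ m)).
- apply: continuous_mulC; last exact: continuous_cstC.
  exact/continuous_expC/polyeval_continuous.
- apply: continuous_mulC; first exact: continuous_cstC.
  exact/continuous_expC/polyeval_continuous.
- move=> c; rewrite fP f'P !exprMn -!exprM mulnC -!mulrA; congr (_ * _).
  exact: mulrC.
Qed.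

(** The positive and negative parts of [r] give two monomials of equal weight. The binomial equation
    between them passes from the orbit to its closure, where one divides by the nonzero
    coordinates. *)
Lemma closure_orbit_character (r : 'I_(N + N) -> int) :
  (forall j, j \in supp x -> hcoord y j != 0) ->
  (forall i, \sum_(j in supp x) G i j * r j = 0) ->
  \prod_(j in supp x) (hcoord y j / hcoord x j) ^ r j = 1.
Proof.
move=> y0 Gr.
pose rp j : nat := if r j is Posz n then n else 0.
(* [Negz n] is [- (n + 1)], whence the successor. *)
pose rn j : nat := if r j is Negz n then n.+1 else 0.
have exprz_rpn (t : R[i]) j : t != 0 -> t ^ r j = t ^+ rp j / t ^+ rn j.
  by move=> t0; rewrite /rp /rn; case: (r j) => n; rewrite /= ?invr1 ?mulr1 ?mul1r.
pose mon (e : 'I_(N + N) -> nat) (z : HNtop R N) : R[i]^o :=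
  \prod_(j in supp x) hcoord z j ^+ e j.
have mon_cont e : continuous (mon e).
  by apply: continuous_prodC => j; exact/continuous_expC/hcoord_continuous.
have mon0 e z : (forall j, j \in supp x -> hcoord z j != 0) -> mon e z != 0.
  by move=> z0; apply/prodf_neq0 => j jx; rewrite expf_neq0 // z0.
have x0 j : j \in supp x -> hcoord x j != 0 by [].
have yxeq : mon rp y * mon rn x = mon rn y * mon rp x.
  apply: (closure_orbit_eq (f := fun z => mon rp z * mon rn x)
    (g := fun z => mon rn z * mon rp x)).
  - by apply: continuous_mulC; [exact: mon_cont|exact: continuous_cstC].
  - by apply: continuous_mulC; [exact: mon_cont|exact: continuous_cstC].
  - move=> c; pose t j := texp ((c *m intmx _ G) 0 j).
    have monE e : mon e (act B c x) = mon e x * \prod_(j in supp x) t j ^+ e j.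
      by rewrite /mon -big_split; apply: eq_bigr => j _; rewrite hcoord_act exprMn.
    have t1 : \prod_(j in supp x) t j ^+ rp j = \prod_(j in supp x) t j ^+ rn j.
      have : \prod_(j in supp x) t j ^ r j = 1.
        rewrite -[RHS](texp0 R) (eq_bigr _ (fun j _ => esym (texpMz _ _))).
        rewrite -texp_sum; congr texp.
        transitivity (\sum_(j in supp x) \sum_i c 0 i * ((G i j * r j)%:~R)).
          apply: eq_bigr => j _; rewrite mxE mulrz_suml; apply: eq_bigr => i _.
          by rewrite intmxE intrM mulrA [RHS]mulrzr.
        rewrite exchange_big big1 // => i _.
        by rewrite -mulr_sumr -(rmorph_sum intr) /= Gr mulr0.
      rewrite (eq_bigr _ (fun j _ => exprz_rpn (t j) j (texp_neq0 _))) big_split /=.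
      by rewrite prodfV => /divr1_eq.
    by rewrite !monE t1; ring.
rewrite (eq_bigr (fun j => (hcoord y j ^+ rp j * hcoord x j ^+ rn j) /
    (hcoord y j ^+ rn j * hcoord x j ^+ rp j))); last first.
  move=> j jx; rewrite exprz_rpn ?mulf_neq0 ?invr_eq0 ?y0 ?x0 //.
  by rewrite !exprMn !exprVn !invfM !invrK; ring.
rewrite big_split prodfV !big_split /= -!/(mon _ _) yxeq divff //.
by rewrite mulf_neq0 // mon0.
Qed.

End ClosureEquations.

(** The closed set is the closure of the orbit. A semistable [y] in it has the support of [x], and
    the ratios of coordinates satisfy every character equation, so [mem_torus_image] yields a torus
    element carrying [x] to [y]. *)
Lemma cone_closed_orbit beta x (c : 'I_(N + N) -> R) :
  muC_ss beta alpha x -> (forall j, 0 < c j) ->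
  intmx R a = \sum_(j in supp x) c j *: intmx R (col j G) ->
  closed_in (muC_ss beta alpha) (KC_orbit k x).
Proof.
move=> [xbeta xss] c0 aE.
have [m [n [m0 an /(_ c0) n0]]] := nat_cone (fun j => ltW (c0 j)) aE.
exists (closure (KC_orbit k x : set (HNtop R N))); first exact: closed_closure.
apply/seteqP; split=> [y xy|y [[ybeta yss] yx]].
  split; last exact: subset_closure.
  by have /KC_orbitP[e ->] := xy; split; [rewrite muC_act|exact: semistable_act].
have [m' [f [m'0 fP fy]]] := (ssP y).1 yss.
(* A semi-invariant [f] nonzero at [y] is compared with the monomial nonzero at [x]: the monomial
   cannot vanish at [y], and all its exponents are positive. *)
have y0 j : j \in supp x -> hcoord y j != 0.
  move=> jx; have := closure_orbit_semi_invariant yx (monomial_semi_invariant an) fP.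
  apply: contra_eq_neq => yj.
  rewrite [X in X ^+ m' * _](_ : _ = 0) ?expr0n ?gtn_eqF // ?mul0r.
    rewrite eq_sym mulf_neq0 // expf_neq0 //.
    rewrite polyeval_monomial; apply/prodf_neq0 => i ix; exact: expf_neq0.
  by rewrite polyeval_monomial (bigD1 j) //= yj expr0n gtn_eqF // mul0r.
have [|e eP] := @mem_torus_image _ _ _ G (supp x) (fun j => hcoord y j / hcoord x j) _
    (fun r => closure_orbit_character yx y0).
  by move=> j jx; rewrite mulf_neq0 ?invr_eq0 ?y0.
apply/KC_orbitP; exists e; apply: hcoord_inj => j; rewrite hcoord_act.
have [xj|xj] := eqVneq (hcoord x j) 0.
  by rewrite xj mul0r; exact: closure_orbit_supp yx _ xj.
by rewrite -eP // mulrC divfK.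
Qed.

End Stability.

Theorem lemma3p4 (R : realType) (N : nat) (K : set 'rV[R[i]]_N)
    (k : {vspace 'rV[R]_N}) (hK : subtorus K) (hk : is_lie_algebra K k)
    (beta : dual_space (complexify k)) (alpha : dual_space k)
    (halpha : integral_dual alpha) :
  (forall x : HN R N, muC k x = beta ->
     (semistable alpha x <-> cone_ge0 k x alpha)) /\
  (forall x : HN R N, muC_ss beta alpha x ->
     (closed_in (muC_ss beta alpha) (KC_orbit k x) <-> cone_gt0 k x alpha)).
Proof.
have [d [B kB]] := lie_algebra_rational hK hk.
have [a alpha_a] := integral_lattice_values kB halpha.
have ge0P x : cone_ge0 k x alpha <-> _ :=
  coneP kB alpha_a (D := [set c : R | 0 <= c]) x ler01
    (fun s t s0 t0 => mulr_ge0 (ltW s0) t0).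
have gt0P x : cone_gt0 k x alpha <-> _ :=
  coneP kB alpha_a (D := [set c : R | 0 < c]) x ltr01 (@mulr_gt0 R).
split=> x xbeta; split.
- by move=> xss; apply/ge0P; exact: (semistable_cone kB halpha alpha_a xss).
- by move=> /ge0P[c c0 aE]; exact: (cone_semistable kB halpha alpha_a c0 aE).
- by move=> cl; apply/gt0P; exact: (closed_orbit_cone kB halpha alpha_a xbeta cl).
- by move=> /gt0P[c c0 aE]; exact: (cone_closed_orbit kB halpha alpha_a xbeta c0 aE).
Qed.
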